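(* Let $d,m,r$ be integers such that $d\ge 1$ is even, $m\ge 2$ and $2\le 2r\le m-1$. Put $\beta=\lfloor rd/(m-2r)\rfloor$ and let $t$ be the remainder of $rd$ modulo $m-2r$ (so $t\equiv rd \pmod{m-2r}$, $0\le t<m-2r$). Then there exists an $m\times m$ complex skew-symmetric matrix polynomial $W\in \mathrm{POL}^{ss}_{d,m\times m}$ of degree exactly $d$ and rank exactly $2r$, with no elementary divisors at all (neither finite nor infinite), with $t$ left minimal indices equal to $\beta+1$ and $m-2r-t$ left minimal indices equal to $\beta$, and with the right minimal indices equal to the left minimal indices, such that the set of $m\times m$ complex skew-symmetric matrix polynomials of grade $d$ with rank at most $2r$ is a closed subset of $\mathrm{POL}^{ss}_{d,m\times m}$ equal to $\overline{\mathrm{O}}(W)$.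
   Context: $\mathrm{POL}^{ss}_{d,m\times m}$ is the vector space of $m\times m$ complex skew-symmetric matrix polynomials of grade $d$, i.e. $P(\lambda)=\sum_{i=0}^d\lambda^iA_i$ with $A_i\in\mathbb C^{m\times m}$, $A_i^T=-A_i$ ($A_d=0$ is allowed); the degree of $P$ is the largest $k$ with $A_k\neq 0$. It carries the topology of the distance $d(P,P')=\big(\sum_{i=0}^d\|A_i-A_i'\|_F^2\big)^{1/2}$. The rank of $P$ is the largest size of a minor that is not identically zero (the rank over $\mathbb C(\lambda)$). Elementary divisors. A skew-symmetric $P$ of rank $2\rho$ satisfies $F(\lambda)^TP(\lambda)F(\lambda)=\begin{bmatrix}0&g_1\\-g_1&0\end{bmatrix}\oplus\cdots\oplus\begin{bmatrix}0&g_\rho\\-g_\rho&0\end{bmatrix}\oplus 0_{m-2\rho}$ for some unimodular matrix polynomial $F$ (constant nonzero determinant) and unique monic polynomials $g_j$ with $g_j\mid g_{j+1}$. For $\alpha\in\mathbb C$ write $g_j=(\lambda-\alpha)^{\sigma_j}p_j$, $p_j(\alpha)\ne0$; the sequence $\sigma_1=\sigma_1\le\sigma_2=\sigma_2\le\dots\le\sigma_\rho=\sigma_\rho$ (each repeated twice) is the sequence of partial multiplicities of $P$ at $\alpha$, and the factors $(\lambda-\alpha)^{\sigma_j}$ with $\sigma_j>0$ (each taken twice) are the elementary divisors at $\alpha$; $\alpha$ is a finite eigenvalue if some $\sigma_j>0$. The partial multiplicities and elementary divisors of $P\in\mathrm{POL}^{ss}_{d,m\times m}$ at $\infty$ are those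 of $\operatorname{rev}_dP(\lambda):=\lambda^dP(1/\lambda)$ at $0$ (they depend on the grade $d$); $\infty$ is an eigenvalue if $0$ is an eigenvalue of $\operatorname{rev}_d P$. Minimal indices. For a subspace $\mathcal V$ of $\mathbb C(\lambda)^m$, a minimal basis is a basis of vector polynomials whose sum of degrees is minimal among all such bases; the ordered list of degrees is independent of the minimal basis, and these are the minimal indices of $\mathcal V$. The left (right) minimal indices of $P$ are those of $\{y^T: y^TP=0\}$ (of $\{x: Px=0\}$) over $\mathbb C(\lambda)$. The complete eigenstructure of $P\in\mathrm{POL}^{ss}_{d,m\times m}$ consists of all its finite and infinite eigenvalues, the corresponding elementary divisors, and its left and right minimal indices. The orbit $\mathrm{O}(P)\subseteq\mathrm{POL}^{ss}_{d,m\times m}$ is the set of all polynomials in $\mathrm{POL}^{ss}_{d,m\times m}$ with the same complete eigenstructure as $P$, and $\overline{\mathrm{O}}(P)$ is its closure in $\mathrm{POL}^{ss}_{d,m\times m}$. *)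

(* Defs.v *)
From HB Require Import structures.
From mathcomp Require Import all_boot all_order all_algebra.
From mathcomp Require Import fraction complex ring lra.
From mathcomp Require Import all_classical all_reals all_analysis.

Set Implicit Arguments.
Unset Strict Implicit.
Unset Printing Implicit Defensive.

Import Order.TTheory GRing.Theory Num.Theory.

Local Open Scope classical_set_scope.
Local Open Scope ring_scope.
Local Open Scope complex_scope.

(* Throughout, the field of complex numbers is R[i] for R : realType. *)

Section EuclideanNorm.
Variable R : realType.

Lemma cauchy_schwarz_sum (I : finType) (x y : I -> R) :
  (\sum_i x i * y i) ^+ 2 <= (\sum_i x i ^+ 2) * (\sum_i y i ^+ 2).
Proof.
set a := \sum_i x i ^+ 2; set b := \sum_i y i ^+ 2; set c := \sum_i x i * y i.
have q t : 0 <= a - 2 * t * c + t ^+ 2 * b.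
  have -> : a - 2 * t * c + t ^+ 2 * b = \sum_i (x i - t * y i) ^+ 2.
    rewrite /a /b /c !mulr_sumr -sumrB -big_split /=.
    by apply: eq_bigr => i _; ring.
  by apply: sumr_ge0 => i _; exact: sqr_ge0.
have a0 : 0 <= a by apply: sumr_ge0 => i _; exact: sqr_ge0.
have : 0 <= b by apply: sumr_ge0 => i _; exact: sqr_ge0.
rewrite le_eqVlt => /predU1P[b0|b0].
  rewrite -b0 mulr0; have [->|c0] := eqVneq c 0; first by rewrite expr0n.
  have := q ((a + 1) / (2 * c)); rewrite -b0 mulr0 addr0.
  have -> : 2 * ((a + 1) / (2 * c)) * c = a + 1 by field.
  by lra.
have := q (c / b).
have -> : a - 2 * (c / b) * c + (c / b) ^+ 2 * b = (a * b - c ^+ 2) / b.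
  by field; rewrite gt_eqF.
by rewrite pmulr_lge0 ?invr_gt0// subr_ge0.
Qed.

Lemma minkowski_sum (I : finType) (x y : I -> R) :
  Num.sqrt (\sum_i (x i + y i) ^+ 2) <=
  Num.sqrt (\sum_i x i ^+ 2) + Num.sqrt (\sum_i y i ^+ 2).
Proof.
have s0 (z : I -> R) : 0 <= \sum_i z i ^+ 2.
  by apply: sumr_ge0 => i _; exact: sqr_ge0.
rewrite -(@ler_pXn2r _ 2) ?nnegrE ?addr_ge0 ?sqrtr_ge0//.
rewrite sqrrD !sqr_sqrtr// -sqrtrM//.
have -> : \sum_i (x i + y i) ^+ 2 =
    \sum_i x i ^+ 2 + (\sum_i x i * y i) *+ 2 + \sum_i y i ^+ 2.
  rewrite -sumrMnl -!big_split /=; apply: eq_bigr => i _; exact: sqrrD.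
rewrite lerD2r lerD2l lerMn2r /=.
apply: (le_trans (ler_norm _)); rewrite -sqrtr_sqr.
exact/ler_wsqrtr/cauchy_schwarz_sum.
Qed.

End EuclideanNorm.

Section SkewPolynomials.
Variables (R : realType) (d m : nat).

(* [POLss R d m] represents P(lambda) = sum_(i <= d) lambda^i A_i by the family
   of its coefficients A_0, ..., A_d. *)
Record POLss := MkPOLss {
  coefs :> {ffun 'I_d.+1 -> 'M[R[i]]_m};
  _ : [forall i, (coefs i)^T == - coefs i]
}.

HB.instance Definition _ := [isSub for coefs].
HB.instance Definition _ := [Choice of POLss by <:].

Definition frobenius (A : 'M[R[i]]_m) : R :=
  Num.sqrt (\sum_i \sum_j ComplexField.Normc.normc (A i j) ^+ 2).

Definition POLdist (P Q : POLss) : R :=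
  Num.sqrt (\sum_i frobenius (P i - Q i) ^+ 2).

Let pnorm (k : 'I_d.+1 * ('I_m * 'I_m)) (P Q : POLss) :=
  ComplexField.Normc.normc (P k.1 k.2.1 k.2.2 - Q k.1 k.2.1 k.2.2).

Let POLdistE P Q : POLdist P Q = Num.sqrt (\sum_k pnorm k P Q ^+ 2).
Proof.
congr (Num.sqrt _).
rewrite -(pair_bigA _ (fun i k => pnorm (i, k) P Q ^+ 2)) /=.
apply: eq_bigr => i _; rewrite sqr_sqrtr.
  rewrite (pair_bigA _ (fun j k =>
    ComplexField.Normc.normc ((P i - Q i) j k) ^+ 2)) /=.
  by apply: eq_bigr => k _; rewrite !mxE.
by apply: sumr_ge0 => j _; apply: sumr_ge0 => k _; exact: sqr_ge0.
Qed.

Let POLdistxx P : POLdist P P = 0.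
Proof.
rewrite POLdistE big1 ?sqrtr0// => k _.
by rewrite /pnorm subrr ComplexField.Normc.normc0 expr0n.
Qed.

Let POLdist_eq0 P Q : POLdist P Q = 0 -> P = Q.
Proof.
rewrite POLdistE => /eqP; rewrite sqrtr_eq0 => le0.
apply: val_inj; apply/ffunP => i; apply/matrixP => j k.
apply/eqP; rewrite -subr_eq0; apply/eqP/ComplexField.Normc.eq0_normc.
have : \sum_k pnorm k P Q ^+ 2 == 0.
  by rewrite eq_le le0 sumr_ge0// => l _; exact: sqr_ge0.
rewrite psumr_eq0 => [/allP/(_ (i, (j, k)))|l _]; last exact: sqr_ge0.
by rewrite mem_index_enum /= sqrf_eq0 => /(_ isT)/eqP.
Qed.

Let POLdist_sym P Q : POLdist P Q = POLdist Q P.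
Proof.
rewrite !POLdistE; congr (Num.sqrt _); apply: eq_bigr => k _.
by rewrite /pnorm -opprB normcN.
Qed.

Let POLdist_triangle Q P S : POLdist P S <= POLdist P Q + POLdist Q S.
Proof.
rewrite !POLdistE; apply: le_trans (minkowski_sum _ _).
apply: ler_wsqrtr; apply: ler_sum => k _.
have n0 (z : R[i]) : 0 <= ComplexField.Normc.normc z.
  by case: z => a b; exact: sqrtr_ge0.
rewrite ler_pXn2r ?nnegrE ?addr_ge0 ?n0//.
apply: le_trans (le_normcD _ _).
by rewrite addrA subrK.
Qed.

HB.instance Definition _ := @isMetric.Build R POLss POLdist
  POLdistxx POLdist_eq0 POLdist_sym POLdist_triangle.

Definition mxpoly (P : POLss) : 'M[{poly R[i]}]_m :=
  \sum_(i < d.+1) 'X^i *: map_mx polyC (P i).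

(* Equal to 0 for the zero polynomial. *)
Definition degree (P : POLss) : nat := \max_(i < d.+1 | P i != 0) i.

Fact revd_subproof (P : POLss) : let f := [ffun i => P (rev_ord i)] in
  [forall i, (f i)^T == - f i].
Proof.
by apply/forallP => i; rewrite !ffunE; case: P => f /= /forallP/(_ (rev_ord i)).
Qed.

(* lambda^d P(1/lambda) *)
Definition revd (P : POLss) : POLss := MkPOLss (revd_subproof P).

End SkewPolynomials.

Section PolynomialMatrices.
Variable R : realType.
Local Notation C := R[i].
Local Notation K := {fraction {poly C}}.

(* \rank (fracmx A) is the rank over C(lambda). *)
Definition fracmx p q (A : 'M[{poly C}]_(p, q)) : 'M[K]_(p, q) :=
  map_mx (@tofrac {poly C}) A.

Definition prank p q (A : 'M[{poly C}]_(p, q)) : nat := \rank (fracmx A).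

Definition unimodular m (F : 'M[{poly C}]_m) : Prop :=
  exists2 c : C, c != 0 & \det F = c%:P.

(* [0 g_1; -g_1 0] (+) ... (+) [0 g_rho; -g_rho 0] (+) 0, where
   g = [:: g_1; ...; g_rho]; this assumes 2 * size g <= m. *)
Definition skew_canonical m (g : seq {poly C}) : 'M[{poly C}]_m :=
  \matrix_(i, j)
    if ~~ odd i && (j == i.+1 :> nat) then g`_(i./2)
    else if ~~ odd j && (i == j.+1 :> nat) then - g`_(j./2)
    else 0.

(* [g] is the list of invariant polynomials of the skew-symmetric matrix [A];
   there is exactly one such list. *)
Definition skew_smith m (A : 'M[{poly C}]_m) (g : seq {poly C}) : Prop :=
  [/\ (2 * size g <= m)%N,
      all (fun p : {poly C} => p \is monic) g,
      sorted (fun p q : {poly C} => p %| q) g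
    & exists2 F : 'M[{poly C}]_m,
        unimodular F & F^T *m A *m F = skew_canonical m g].

(* Partial multiplicities, elementary divisors and minimal indices are uniquely
   determined by A; they are presented as functional relations. *)
Definition partial_multiplicities m (A : 'M[{poly C}]_m) (a : C)
    (s : seq nat) : Prop :=
  exists2 g, skew_smith A g & s = flatten [seq [:: mup a p; mup a p] | p <- g].

Definition elementary_divisors m (A : 'M[{poly C}]_m) (a : C)
    (e : seq {poly C}) : Prop :=
  exists2 s, partial_multiplicities A a s &
    e = [seq ('X - a%:P) ^+ n | n <- s & (0 < n)%N].

Definition eigenvalue m (A : 'M[{poly C}]_m) (a : C) : Prop :=
  exists2 s, partial_multiplicities A a s & has (fun n => 0 < n)%N s.

Definition vdegree p q (v : 'M[{poly C}]_(p, q)) : nat :=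
  \max_i \max_j (size (v i j)).-1.

Definition polynomial_basis p q (V : {vspace 'M[K]_(p, q)})
    (X : seq 'M[{poly C}]_(p, q)) : Prop :=
  basis_of V [seq fracmx v | v <- X].

Definition minimal_basis p q (V : {vspace 'M[K]_(p, q)})
    (X : seq 'M[{poly C}]_(p, q)) : Prop :=
  polynomial_basis V X /\
  forall Y, polynomial_basis V Y ->
    (\sum_(v <- X) vdegree v <= \sum_(v <- Y) vdegree v)%N.

Definition minimal_indices p q (V : {vspace 'M[K]_(p, q)}) (s : seq nat) : Prop :=
  exists2 X, minimal_basis V X & s = sort leq [seq vdegree v | v <- X].

(* {y^T : y^T A = 0} and {x : A x = 0} over C(lambda). *)
Definition left_nullspace m (A : 'M[{poly C}]_m) : {vspace 'rV[K]_m} :=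
  lker (linfun (mulmxr (fracmx A) : 'rV[K]_m -> 'rV[K]_m)).

Definition right_nullspace m (A : 'M[{poly C}]_m) : {vspace 'cV[K]_m} :=
  lker (linfun (mulmx (fracmx A) : 'cV[K]_m -> 'cV[K]_m)).

Definition left_minimal_indices m (A : 'M[{poly C}]_m) (s : seq nat) : Prop :=
  minimal_indices (left_nullspace A) s.

Definition right_minimal_indices m (A : 'M[{poly C}]_m) (s : seq nat) : Prop :=
  minimal_indices (right_nullspace A) s.

End PolynomialMatrices.

Section Eigenstructure.
Variables (R : realType) (d m : nat).
Implicit Types P Q : POLss R d m.

Definition infinite_elementary_divisors P (e : seq {poly R[i]}) : Prop :=
  elementary_divisors (mxpoly (revd P)) 0 e.

Definition infinite_eigenvalue P : Prop := eigenvalue (mxpoly (revd P)) 0.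

Record same_eigenstructure P Q : Prop := {
  same_finite_eigenvalues :
    forall a, eigenvalue (mxpoly P) a <-> eigenvalue (mxpoly Q) a;
  same_infinite_eigenvalue :
    infinite_eigenvalue P <-> infinite_eigenvalue Q;
  same_finite_elementary_divisors :
    forall a e, elementary_divisors (mxpoly P) a e <->
                elementary_divisors (mxpoly Q) a e;
  same_infinite_elementary_divisors :
    forall e, infinite_elementary_divisors P e <->
              infinite_elementary_divisors Q e;
  same_left_minimal_indices :
    forall s, left_minimal_indices (mxpoly P) s <->
              left_minimal_indices (mxpoly Q) s;
  same_right_minimal_indices :
    forall s, right_minimal_indices (mxpoly P) s <->
              right_minimal_indices (mxpoly Q) s
}.

Definition eigen_orbit P : set (POLss R d m) := [set Q | same_eigenstructure P Q].

End Eigenstructure.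

(* Main.v *)
From HB Require Import structures.
Require Import Defs.
From mathcomp Require Import all_boot all_order all_algebra.
From mathcomp Require Import complex.
From mathcomp Require Import all_classical all_reals all_analysis.
From mathcomp Require Import perm fraction ring zify.

(** The set S of the skew-symmetric polynomials of rank at most 2r is closed
    because an invertible minor at one point persists under perturbation
    (prank_le_closed). The other half of the theorem is that the polynomials
    with the eigenstructure of W are dense in S.

    Write X ^ Y for wedge X Y = X Y^T - Y X^T, and let d = 2h. Three
    deformations lead from an arbitrary P in S to the orbit of W.

    - P is exactly of the form X ^ Y, where X and Y have r columns and the
      degrees of the k-th columns of X and Y add up to at most d
      (graded_wedge_decomposition). Indeed P is a skew form on the trivial
      bundle over the projective line, with values in O(d). As long as the form
      degenerates at some point, finite or infinite, an elementary modification
      of the bundle at this point removes a part of the degeneracy. A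
      nondegenerate form contains a constant entry of the right degree, and
      splits off a hyperbolic plane, that is, one pair of columns.

    - If x and y have degrees h - s and h + s, write y = v + u 'X^s with u and v
      of degree at most h. Then (x + e u) ^ (v - e^-1 'X^s x) equals
      x ^ y + e (u ^ v) and involves vectors of degree at most h only. Hence P is
      a limit of products X ^ Y with all degrees at most h
      (graded_wedge_balance).

    - Let B = [X Y], an m x 2r matrix of degree at most h, and let beta be the
      quotient in the statement. The products v B, for v of degree at most
      beta, fill the space of vectors of degree at most beta + h, and v B = 0
      has no solution v != 0 of degree below beta, for all B outside a proper
      algebraic subset (generic_matrix). This can be tested on lines
      (generic_on_line), and the subset is proper because of an explicit zigzag
      matrix (zigzag_rank). Hence X ^ Y is a limit of products with B generic.

    It remains to see that B generic determines the eigenstructure of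
    P = X ^ Y. Surjectivity gives a polynomial left inverse of B, so that P has
    constant rank 2r, also at infinity, and a unimodular completion of B reduces
    P to constant hyperbolic planes: there are no elementary divisors
    (wedge_elementary_divisors). The null vectors of P are those of B. Their
    spaces of bounded degree have known dimensions, which leaves only the
    minimal indices beta and beta + 1 with the multiplicities of the statement
    (wedge_left_minimal_indices); transposition gives the right ones. *)

Set Implicit Arguments.
Unset Strict Implicit.
Unset Printing Implicit Defensive.

Import Order.TTheory GRing.Theory Num.Theory.

Local Open Scope classical_set_scope.
Local Open Scope ring_scope.
Local Open Scope complex_scope.

(** * Polynomials and minors *)

Section WeightedDegree.
Variable F : fieldType.
Implicit Types p q : {poly F}.

(** The bound deg p <= e - c, which forces p = 0 when e < c; multiplying by
    'X^c avoids the truncated subtraction. *)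
Definition wdeg_le (c e : nat) p := (size (p * 'X^c)%R <= e.+1)%N.

Lemma wdeg_leE c e p : wdeg_le c e p = (p == 0) || (size p + c <= e.+1)%N.
Proof.
rewrite /wdeg_le; have [->|p0] := eqVneq p 0; first by rewrite mul0r size_poly0.
by rewrite size_mulXn // addnC.
Qed.

Lemma wdeg_le0 c e : wdeg_le c e 0.
Proof. by rewrite wdeg_leE eqxx. Qed.

Lemma wdeg_leD c e p q : wdeg_le c e p -> wdeg_le c e q -> wdeg_le c e (p + q).
Proof.
rewrite /wdeg_le mulrDl => hp hq; apply: leq_trans (size_polyD _ _) _.
by rewrite geq_max hp.
Qed.

Lemma wdeg_leN c e p : wdeg_le c e (- p) = wdeg_le c e p.
Proof. by rewrite /wdeg_le mulNr size_polyN. Qed.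

Lemma wdeg_le_sum c e (I : Type) (s : seq I) (P : pred I) (f : I -> {poly F}) :
  (forall i, P i -> wdeg_le c e (f i)) -> wdeg_le c e (\sum_(i <- s | P i) f i).
Proof. by move=> h; apply: (big_ind (wdeg_le c e)) h => [|p q]; [exact: wdeg_le0|exact: wdeg_leD]. Qed.

Lemma wdeg_leM c e c' e' p q : wdeg_le c e p -> wdeg_le c' e' q ->
  wdeg_le (c + c') (e + e') (p * q).
Proof.
rewrite /wdeg_le exprD mulrACA => hp hq.
apply: leq_trans (size_polyMleq _ _) _; move: hp hq; set a := size _; set b := size _; lia.
Qed.

Lemma wdeg_le_shift c e k p : wdeg_le (c + k) (e + k) p = wdeg_le c e p.
Proof. by rewrite !wdeg_leE -addSn addnA leq_add2r. Qed.

Lemma wdeg_le_weaken c e c' e' p : wdeg_le c e p -> (e + c' <= e' + c)%N ->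
  wdeg_le c' e' p.
Proof. by rewrite !wdeg_leE => /orP[->//|h] h'; apply/orP; right; move: (size p) h => a; lia. Qed.

Lemma wdeg_leC a : wdeg_le 0 0 a%:P.
Proof. by rewrite wdeg_leE addn0 size_polyC leq_b1 orbT. Qed.

End WeightedDegree.

Section DetTop.
Variable F : fieldType.

Lemma coef_prod_top (I : Type) (s : seq I) (f : I -> {poly F}) d :
  (forall i, (size (f i) <= d.+1)%N) ->
  (size (\prod_(i <- s) f i)%R <= (size s * d).+1)%N /\
  (\prod_(i <- s) f i)`_(size s * d) = \prod_(i <- s) (f i)`_d.
Proof.
move=> hf; elim: s => [|i s [IH1 IH2]] /=.
  by rewrite !big_nil size_poly1 mul0n coef1.
rewrite !big_cons mulSn; set p := f i; set q := \prod_(j <- s) _.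
have hp : (size p <= d.+1)%N by exact: hf.
rewrite -IH2; move: (size s * d)%N IH1 => e hq; split.
  apply: leq_trans (size_polyMleq _ _) _.
  by move: (size p) (size q) hp hq => a b; lia.
rewrite coefM (bigD1 (inord d)) //= inordK; last by lia.
rewrite addKn big1 ?addr0 // => j /negP hj.
case: (ltngtP j d) => hjd.
- by rewrite [q`__]nth_default ?mulr0 //; apply: leq_trans hq _; lia.
- by rewrite nth_default ?mul0r //; apply: leq_trans hp _.
by case: hj; apply/eqP/val_inj; rewrite /= inordK //; lia.
Qed.

(** In the largest possible degree each term of the permutation expansion
    contributes the product of its top coefficients. *)
Lemma det_coef_top n (A : 'M[{poly F}]_n) d :
  (forall i j, (size (A i j) <= d.+1)%N) ->
  (\det A)`_(n * d) = \det (\matrix_(i, j) (A i j)`_d).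
Proof.
move=> hA; have h (s : 'S_n) := coef_prod_top (index_enum 'I_n) (fun i => hA i (s i)).
have sz : size (index_enum 'I_n) = n by rewrite -[index_enum _]enumT size_enum_ord.
rewrite sz in h; rewrite coef_sum; apply: eq_bigr => s _.
rewrite -signr_odd -[in RHS]signr_odd; case: odd; rewrite ?mul1r ?mulN1r ?coefN (h s).2.
  by congr (- _); apply: eq_bigr => i _; rewrite mxE.
by apply: eq_bigr => i _; rewrite mxE.
Qed.

End DetTop.

(** The freedom in the sequence u is what allows nonroots close to 0. *)
Lemma nonroot_seq (F : fieldType) (f : {poly F}) (u : nat -> F) : injective u -> f != 0 ->
  exists n, f.[u n] != 0.
Proof.
move=> ui f0; pose s := [seq u i | i <- iota 0 (size f)].
have : ~~ all (root f) s.
  apply/negP => rs; have us : uniq s by rewrite map_inj_uniq ?iota_uniq.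
  by have := max_poly_roots f0 rs us; rewrite size_map size_iota ltnn.
by case/allPn => x /mapP[i _ ->] h; exists i.
Qed.

Lemma poly_nonroot (F : numFieldType) (f : {poly F}) : f != 0 ->
  exists n : nat, f.[n%:R] != 0.
Proof. by apply: nonroot_seq => i j /eqP; rewrite eqr_nat => /eqP. Qed.

Lemma rank_mxsub (F : fieldType) m n p q (f : 'I_p -> 'I_m) (g : 'I_q -> 'I_n) (A : 'M[F]_(m, n)) :
  (\rank (mxsub f g A) <= \rank A)%N.
Proof.
rewrite mxsubrc; apply: leq_trans (mxrankS (rowsub_sub f _)) _.
by rewrite -mxrank_tr trmx_mxsub -[X in (_ <= X)%N]mxrank_tr mxrankS // rowsub_sub.
Qed.

Lemma minor_exists (F : fieldType) m n (A : 'M[F]_(m, n)) :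
  exists f g, (mxsub f g A : 'M[F]_(\rank A)) \in unitmx.
Proof.
have free := maxrowsub_free A; set N := rowsub _ A in free.
have full : row_full N^T by rewrite /row_full mxrank_tr.
exists (maxrankfun A), (fullrankfun full).
have := fullrowsub_unit full; rewrite -unitmx_tr trmx_mxsub trmxK.
by congr (_ \in unitmx); apply/matrixP => i j; rewrite !mxE.
Qed.

(** * Wedges of families of columns *)

(** The sum of the x_k y_k^T - y_k x_k^T, where the x_k and y_k are the columns
    of X and Y. *)
Definition wedge (T : pzRingType) m r (X Y : 'M[T]_(m, r)) : 'M[T]_m :=
  X *m Y^T - Y *m X^T.

Lemma wedge_row_mx (T : pzRingType) m r1 r2 (X1 Y1 : 'M[T]_(m, r1)) (X2 Y2 : 'M[_]_(m, r2)) :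
  wedge (row_mx X1 X2) (row_mx Y1 Y2) = wedge X1 Y1 + wedge X2 Y2.
Proof. by rewrite /wedge !tr_row_mx !mul_row_col opprD addrACA. Qed.

Lemma wedgeE (T : pzRingType) m r (X Y : 'M[T]_(m, r)) a b :
  wedge X Y a b = \sum_k (X a k * Y b k - Y a k * X b k).
Proof. by rewrite !mxE -sumrB; apply: eq_bigr => k _; rewrite !mxE. Qed.

Lemma wedgeC (T : pzRingType) m r (X Y : 'M[T]_(m, r)) : wedge X Y = - wedge Y X.
Proof. by rewrite /wedge opprB. Qed.

Lemma tr_wedge (T : comPzRingType) m r (X Y : 'M[T]_(m, r)) : (wedge X Y)^T = - wedge X Y.
Proof. by rewrite /wedge linearB /= !trmx_mul !trmxK opprB. Qed.

Lemma wedge_mull (T : comPzRingType) m n r (A : 'M[T]_(n, m)) (X Y : 'M[T]_(m, r)) :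
  wedge (A *m X) (A *m Y) = A *m wedge X Y *m A^T.
Proof. by rewrite /wedge mulmxBr mulmxBl !trmx_mul !mulmxA. Qed.

Lemma map_wedge (T U : pzRingType) (f : {rmorphism T -> U}) m r (X Y : 'M[T]_(m, r)) :
  map_mx f (wedge X Y) = wedge (map_mx f X) (map_mx f Y).
Proof. by rewrite /wedge map_mxB !map_mxM !map_trmx. Qed.

Section WedgeBilinear.
Variables (T : comPzRingType) (m r : nat).
Implicit Types X Y Z : 'M[T]_(m, r).

Lemma wedgeDl X Y Z : wedge (X + Y) Z = wedge X Z + wedge Y Z.
Proof. by rewrite /wedge linearD /= mulmxDl mulmxDr opprD addrACA. Qed.

Lemma wedgeDr X Y Z : wedge Z (X + Y) = wedge Z X + wedge Z Y.
Proof. by rewrite wedgeC wedgeDl opprD -!(wedgeC Z). Qed.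

Lemma wedgeZl a X Y : wedge (a *: X) Y = a *: wedge X Y.
Proof. by rewrite /wedge linearZ /= -scalemxAl -scalemxAr scalerBr. Qed.

Lemma wedgeZr a X Y : wedge X (a *: Y) = a *: wedge X Y.
Proof. by rewrite wedgeC wedgeZl -scalerN -wedgeC. Qed.

Lemma wedgeNr X Y : wedge X (- Y) = - wedge X Y.
Proof. by rewrite -scaleN1r wedgeZr scaleN1r. Qed.

Lemma wedge_symr X Y (D : 'M[T]_r) : D^T = D -> wedge X (Y *m D) = wedge (X *m D) Y.
Proof. by move=> DT; rewrite /wedge !trmx_mul DT !mulmxA. Qed.

End WedgeBilinear.

(** * Graded reduction of skew-symmetric polynomial matrices *)
Section SkewReduction.

(** When the combination y of the rows of Q is divisible by pi, the factor pi can
    be divided out of row i and of column i at the same time, because the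
    diagonal entry, which would have to be divided twice, is zero. G undoes the
    reduction, and H, its inverse up to the scalar pi, shows that the rank is
    preserved. *)
Lemma skew_elementary_reduction (T : idomainType) n (Q : 'M[T]_n) (i : 'I_n) (y z : 'I_n -> T) (pi : T) :
  (2%:R != 0 :> T) -> Q^T = - Q -> y i = 1 -> (forall j, pi * z j = \sum_k y k * Q k j) ->
  let Q2 := \matrix_(a, b) (if a == i then (if b == i then 0 else z b)
                            else if b == i then - z a else Q a b) in
  let G := \matrix_(a, b) (if a == i then (if b == i then pi else - y b)
                           else (a == b)%:R) in
  let H := \matrix_(a, b) (if a == i then y b else pi * (a == b)%:R) in
  [/\ Q2^T = - Q2, Q = G *m Q2 *m G^T & H *m G = pi%:M].
Proof.
move=> two0 Qskew yi hz Q2 G H.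
have Qs a b : Q a b = - Q b a.
  by have := congr1 (fun M : 'M[_]_n => M b a) Qskew; rewrite !mxE.
have Qd a : Q a a = 0.
  apply/eqP; have /eqP := Qs a a; rewrite -addr_eq0 -mulr2n -mulr_natl mulf_eq0.
  by rewrite (negPf two0).
have GM m (M : 'M[T]_(n, m)) a b : (G *m M) a b =
    if a == i then pi * M i b - \sum_(k | k != i) y k * M k b else M a b.
  rewrite mxE; have [->|ai] := eqVneq a i.
    rewrite (bigD1 i) //= mxE !eqxx; congr (_ + _); rewrite -sumrN.
    by apply: eq_bigr => k ki; rewrite mxE eqxx (negPf ki) mulNr.
  rewrite (bigD1 a) //= mxE (negPf ai) eqxx mul1r big1 ?addr0 // => k ka.
  by rewrite mxE (negPf ai) eq_sym (negPf ka) mul0r.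
have Q2s : Q2^T = - Q2.
  apply/matrixP => a b; rewrite !mxE.
  by have [_|_] := eqVneq a i; have [_|_] := eqVneq b i; rewrite ?oppr0 ?opprK // Qs.
have Gskew : (G *m Q2 *m G^T)^T = - (G *m Q2 *m G^T).
  by rewrite !trmx_mul trmxK Q2s mulNmx mulmxN mulmxA.
split=> //.
  set M := G *m Q2 *m G^T.
  have Ms a b : M a b = - M b a.
    by have := congr1 (fun M : 'M[_]_n => M b a) Gskew; rewrite !mxE.
  have MQ a b : b != i -> M a b = Q a b.
    move=> bi; rewrite /M -[M a b]/(M a b).
    have -> : (G *m Q2 *m G^T) a b = (G *m Q2) a b.
      rewrite mxE (bigD1 b) //= big1 ?addr0.
        by rewrite !mxE (negPf bi) eqxx mulr1.
      move=> k kb; rewrite [G^T _ _]mxE [G _ _]mxE (negPf bi) eq_sym (negPf kb).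
      by rewrite mulr0.
    rewrite GM; have [->|ai] := eqVneq a i; last first.
      by rewrite mxE (negPf ai) (negPf bi).
    rewrite mxE eqxx (negPf bi) hz (bigD1 i) //= yi mul1r [X in _ - X](_ : _ = \sum_(k | k != i) y k * Q k b).
      by rewrite addrK.
    by apply: eq_bigr => k ki; rewrite mxE (negPf ki) (negPf bi).
  apply/matrixP => a b; have [->|bi] := eqVneq b i; last by rewrite MQ.
  have [->|ai] := eqVneq a i; last by rewrite Ms MQ // Qs.
  rewrite Qd; apply/esym/eqP; have /eqP := Ms i i; rewrite -addr_eq0 -mulr2n -mulr_natl mulf_eq0.
  by rewrite (negPf two0).
apply/matrixP => a b; rewrite mxE; have [->|ai] := eqVneq a i.
  rewrite (bigD1 i) //= !mxE eqxx yi mul1r.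
  have [->|bi] := eqVneq b i.
    rewrite big1 ?addr0 // => k ki.
    by rewrite !mxE !eqxx (negPf ki) mulr0.
  rewrite (bigD1 b) //= !mxE eqxx (negPf bi) eqxx mulr1 big1 ?addr0.
    by rewrite mulr0n addNr.
  by move=> k /andP[ki kb]; rewrite !mxE (negPf ki) (negPf kb) mulr0.
rewrite (bigD1 a) //= !mxE (negPf ai) eqxx mulr1 big1 ?addr0.
  by rewrite mulr_natr.
by move=> k ka; rewrite !mxE (negPf ai) eq_sym (negPf ka) mulr0 mul0r.
Qed.
End SkewReduction.

Section SkewRank.
Variable K : fieldType.

(** The subtracted matrix has the rows and columns i and j of A, so that these
    vanish in the difference; the rows i and j of A are then independent from
    the rows of the difference. *)
Lemma rank_skew_pivot n (A : 'M[K]_n) i j (q := A i j) :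
  2%:R != 0 :> K -> A^T = - A -> q != 0 ->
  ((\rank (A - wedge (q^-1 *: col i A) (col j A))%R).+2 <= \rank A)%N.
Proof.
move=> two0 Askew q0; set B := A - _.
have As a b : A a b = - A b a.
  by have := congr1 (fun M : 'M[_]_n => M b a) Askew; rewrite !mxE.
have Ad a : A a a = 0.
  apply/eqP; have /eqP := As a a; rewrite -addr_eq0 -mulr2n -mulr_natl mulf_eq0.
  by rewrite (negPf two0).
have Be a b : B a b = A a b - q^-1 * (A a i * A b j - A a j * A b i).
  by rewrite !mxE !big_ord1 !mxE; ring.
have BA : (B <= A)%MS.
  have colA k : (col k A)^T = - (delta_mx 0 k *m A).
    by rewrite -rowE; apply/rowP => b; rewrite !mxE As.
  rewrite /B /wedge linearZ /= !colA -scalemxAr -scalemxAl !mulmxN !scalerN.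
  apply: addmx_sub => //; rewrite eqmx_opp; apply: addmx_sub.
    by rewrite eqmx_opp; apply: scalemx_sub; rewrite mulmxA submxMl.
  by rewrite opprK; apply: scalemx_sub; rewrite mulmxA submxMl.
(* Multiplication by D on the right extracts the columns i and j: it kills B,
   and has rank two on A. *)
pose f (k : 'I_2) := if k == 0 then i else j.
pose D : 'M[K]_(n, 2) := \matrix_(a, k) (a == f k)%:R.
have MD m (M : 'M[K]_(m, n)) a k : (M *m D) a k = M a (f k).
  rewrite mxE (bigD1 (f k)) //= mxE eqxx mulr1 big1 ?addr0 // => b bf.
  by rewrite mxE (negPf bf) mulr0.
have BD : B *m D = 0.
  apply/matrixP => a k; rewrite MD Be mxE /f; case: (k == 0).
    by rewrite Ad -/q; field.
  by rewrite Ad (As j i) -/q; field.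
rewrite -(mxrank_mul_ker A D) -add2n; apply: leq_add; last first.
  by apply: mxrankS; rewrite sub_capmx BA; apply/sub_kermxP.
have DM m (M : 'M[K]_(n, m)) k b : (D^T *m M) k b = M (f k) b.
  rewrite mxE (bigD1 (f k)) //= !mxE eqxx mul1r big1 ?addr0 // => a af.
  by rewrite !mxE (negPf af) mul0r.
apply: leq_trans (mxrankM_maxr D^T _); rewrite mxrank_unit //.
have [] // := @mulmx1_unit _ _ (D^T *m (A *m D)) (- q^-1 ^+ 2 *: (D^T *m (A *m D))).
have sc x a b : (x *: (D^T *m (A *m D))) a b = x * (D^T *m (A *m D)) a b by rewrite mxE.
apply/matrixP => a b; rewrite [LHS]mxE [RHS]mxE !big_ord_recl big_ord0 !sc !DM !MD.
case: a => [[|[|//]]] ?; case: b => [[|[|//]]] ?; rewrite /f /= ?Ad ?(As j i) -?/q; by field.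
Qed.

End SkewRank.

Section GradedReduction.
Variable C : closedFieldType.
Hypothesis two0 : 2%:R != 0 :> C.
Variables (n d : nat) (c : 'I_n -> nat) (Q : 'M[{poly C}]_n).
Hypothesis Qdeg : forall i j, wdeg_le (c i + c j) d (Q i j).

(** The value at infinity of the form Q. *)
Let L := \matrix_(i, j) (Q i j * 'X^(c i + c j))`_d.

(** If Q is nonsingular at every finite point, then det Q is a nonzero constant.
    If L is nonsingular as well, then det Q has degree n d - 2 (c_1 + ... + c_n),
    so that this number is 0. The factors Q i (s i) of a nonzero term of the
    permutation expansion have degrees at most d - c i - c (s i), whose sum is 0:
    each of them is a pivot, i.e. a nonzero constant with c i + c (s i) = d. *)
Lemma graded_degenerate : (0 < n)%N ->
  (forall i j, size (Q i j) = 1%N -> c i + c j = d -> False)%N ->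
  (exists a, exists2 x : 'rV[C]_n, x != 0 & x *m map_mx (horner_eval a) Q = 0) \/
  (exists2 x : 'rV[C]_n, x != 0 & x *m L = 0).
Proof.
move=> n0 nopivot; have [sz1|/closed_rootP[a ra]] := eqVneq (size (\det Q)) 1%N; last first.
  left; exists a; apply/det0P; rewrite det_map_mx; exact: ra.
right; apply/det0P; apply/negP => /negP detL0.
pose Qt := \matrix_(i, j) (Q i j * 'X^(c i + c j)).
have tope := @det_coef_top _ _ Qt d (fun i j => ltac:(by rewrite mxE; exact: Qdeg)).
pose D := diag_mx (\row_i 'X^(c i) : 'rV[{poly C}]_n).
have detD : \det D = 'X^(\sum_i c i).
  by rewrite det_diag; under eq_bigr do rewrite mxE; rewrite -expr_sum.
have QtE : Qt = D *m Q *m D.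
  apply/matrixP => i j; rewrite mul_diag_mx mul_mx_diag !mxE exprD.
  by rewrite mulrCA mulrA.
have detQ0 : \det Q != 0 by rewrite -size_poly_eq0 sz1.
have sumc : (\sum_i c i + \sum_i c i = n * d)%N.
  have : (\det Qt)`_(n * d) != 0.
    rewrite tope; congr (\det _ != 0): detL0; apply/matrixP => i j.
    by rewrite !mxE.
  rewrite QtE !det_mulmx detD [_ * \det Q]mulrC -mulrA -exprD.
  have /size_poly1P[q q0 ->] : size (\det Q) == 1%N by apply/eqP.
  rewrite coefCM coefXn; have [->//|_] := eqVneq (n * d)%N; by rewrite mulr0 eqxx.
have [s sn0] : exists s : 'S_n, \prod_i Q i (s i) != 0.
  apply/existsP; apply: contraR detQ0; rewrite negb_exists => /forallP h.
  by rewrite /determinant big1 // => s _; have /negbNE/eqP-> := h s; rewrite mulr0.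
have Q0 i : Q i (s i) != 0.
  by apply: contraNneq sn0 => h; rewrite (bigD1 i) //= h mul0r.
have hb i : (size (Q i (s i)) + (c i + c (s i)) <= d.+1)%N.
  by have := Qdeg i (s i); rewrite wdeg_leE (negPf (Q0 i)).
have hs i : (0 < size (Q i (s i)))%N by rewrite size_poly_gt0.
have hc i : (c i + c (s i) <= d)%N.
  by move: (hb i) (hs i); move: (size _) => a; lia.
have : (\sum_i (d - (c i + c (s i))) == 0)%N.
  rewrite sumnB; last by move=> i _; exact: hc.
  have h : (\sum_i c i = \sum_i c (s i))%N by rewrite (reindex_inj (@perm_inj _ s)).
  rewrite big_split /= -h sumc.
  by rewrite sum_nat_const card_ord subnn.
rewrite sum_nat_eq0 => /forallP/(_ (Ordinal n0)) /=; rewrite subn_eq0 => hle.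
have hd : (c (Ordinal n0) + c (s (Ordinal n0)) = d)%N by apply/eqP; rewrite eqn_leq hc.
apply: (nopivot _ _ _ hd).
by move: (hb (Ordinal n0)) (hs (Ordinal n0)); rewrite hd; move: (size _) => a; lia.
Qed.

(** What skew_elementary_reduction needs in order to raise the weight c i by one
    while keeping all degree bounds. *)
Definition reducing_step (i : 'I_n) (y z : 'I_n -> {poly C}) (pi : {poly C}) :=
  [/\ y i = 1, forall k, wdeg_le (c i) (c k) (y k), wdeg_le 0 1 pi /\ pi != 0,
      forall j, pi * z j = \sum_k y k * Q k j &
      forall j, wdeg_le (c i + c j).+1 d (z j)].

(** A combination of rows can be substituted for its row of least weight without
    violating the degree bounds. *)
Lemma min_weight_support (x : 'rV[C]_n) : x != 0 ->
  exists2 i, x 0 i != 0 & forall k, x 0 k != 0 -> (c i <= c k)%N.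
Proof.
case/rV0Pn => i xi.
have [j xj hj] := @arg_minnP _ i (fun k => x 0 k != 0) c xi.
by exists j.
Qed.

Lemma combination_wdeg i (y : 'I_n -> {poly C}) j :
  (forall k, wdeg_le (c i) (c k) (y k)) ->
  wdeg_le (c i + c j) d (\sum_k y k * Q k j).
Proof.
move=> hy; apply: wdeg_le_sum => k _; rewrite -(wdeg_le_shift _ _ (c k)).
have -> : (c i + c j + c k = c i + (c k + c j))%N by lia.
by rewrite (addnC d); apply: wdeg_leM.
Qed.

(** At a finite point a, the factor 'X - a is divided out of the combination of
    rows that vanishes at a. At infinity nothing is divided, pi = 1, but the
    cancellation of the top coefficients lowers the degree of the combination. *)
Lemma reducing_step_exists : 
  (exists a, exists2 x : 'rV[C]_n, x != 0 & x *m map_mx (horner_eval a) Q = 0) \/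
  (exists2 x : 'rV[C]_n, x != 0 & x *m L = 0) ->
  exists i y z pi, reducing_step i y z pi.
Proof.
case=> [[a]|] [x x0 xQ]; have [i xi hi] := min_weight_support x0.
  pose y k := (x 0 k / x 0 i)%:P.
  have hy k : wdeg_le (c i) (c k) (y k).
    rewrite wdeg_leE /y; have [->|xk] := eqVneq (x 0 k) 0; first by rewrite mul0r eqxx.
    by rewrite size_polyC mulf_neq0 ?invr_eq0 // add1n ltnS hi // orbT.
  pose s j := \sum_k y k * Q k j.
  have rs j : root (s j) a.
    rewrite /root horner_sum; under eq_bigr do rewrite hornerM hornerC mulrAC.
    rewrite -mulr_suml mulf_eq0; apply/orP; left.
    have := congr1 (fun M : 'rV_n => M 0 j) xQ; rewrite !mxE => /eqP; congr (_ == 0).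
    by apply: eq_bigr => k _; rewrite !mxE.
  exists i, y, (fun j => s j %/ ('X - a%:P)), ('X - a%:P); split=> //.
  - by rewrite /y divff.
  - by rewrite wdeg_leE size_XsubC polyXsubC_eq0.
  - by move=> j; rewrite mulrC divpK // dvdp_XsubCl.
  move=> j; have := combination_wdeg j hy; rewrite -/(s j) !wdeg_leE.
  rewrite size_divp ?polyXsubC_eq0 // size_XsubC subn1.
  case/orP=> [/eqP->|h]; first by rewrite div0p eqxx.
  have [->|z0] := eqVneq (s j) 0; first by rewrite div0p eqxx.
  apply/orP; right; move: h; have: (0 < size (s j))%N by rewrite size_poly_gt0.
  by move: (size (s j)) => b; lia.
pose y k := (x 0 k / x 0 i)%:P * 'X^(c k - c i).
have hy k : wdeg_le (c i) (c k) (y k).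
  rewrite /y; have [->|xk] := eqVneq (x 0 k) 0; first by rewrite mul0r mul0r wdeg_le0.
  rewrite /wdeg_le -mulrA -exprD subnK ?hi // size_Cmul ?size_polyXn //.
  by rewrite mulf_neq0 ?invr_eq0.
exists i, y, (fun j => \sum_k y k * Q k j), 1; split=> //.
- by rewrite /y divff // subnn mulr1.
- by rewrite wdeg_leE size_poly1 orbT oner_neq0.
- by move=> j; rewrite mul1r.
move=> j; have := combination_wdeg j hy; rewrite /wdeg_le => hs.
rewrite exprS mulrCA; set p := _ * _ in hs *.
have : p`_d = 0.
  have xL0 : (\sum_k x 0 k * L k j) / x 0 i = 0.
    by have := congr1 (fun M : 'rV_n => M 0 j) xQ; rewrite !mxE => ->; rewrite mul0r.
  rewrite /p mulr_suml coef_sum -[RHS]xL0 mulr_suml; apply: eq_bigr => k _; rewrite mxE.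
  have [xk|xk] := eqVneq (x 0 k) 0; first by rewrite /y xk !mul0r coef0.
  rewrite [RHS]mulrAC /y -2!(mulrA _%:P) coefCM; congr (_ * _`_d).
  by rewrite mulrAC -exprD addnA subnK ?hi // mulrC.
move=> pd; have {pd hs} sp : (size p <= d)%N.
  apply/leq_sizeP => k; rewrite leq_eqVlt => /predU1P[<-//|dk].
  by rewrite nth_default //; apply: leq_trans hs _.
by have [->|p0] := eqVneq p 0; rewrite ?mulr0 ?size_poly0 // mulrC size_mulX.
Qed.

End GradedReduction.

(** * Decomposition into pairs of columns of complementary degrees *)
Section WedgeDecomposition.
Variable C : closedFieldType.
Hypothesis two0 : 2%:R != 0 :> C.
Local Notation K := {fraction {poly C}}.
Local Notation tf := (@tofrac {poly C}).

Let two0P : 2%:R != 0 :> {poly C}.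
Proof. by rewrite -[2%:R](rmorph_nat polyC) polyC_eq0. Qed.

Let two0K : 2%:R != 0 :> K.
Proof. by rewrite -[2%:R](rmorph_nat tf) tofrac_eq0. Qed.

(** In the k-th pair of columns, a k and d - a k bound the degrees of the two
    vectors once the weights c of the coordinates are added; the vector with the
    smaller bound comes first. *)
Definition graded_wedge n (c : 'I_n -> nat) d r (Q : 'M[{poly C}]_n) :=
  exists X Y : 'M[{poly C}]_(n, r), exists a : 'I_r -> nat,
    [/\ forall k, ((a k).*2 <= d)%N, forall i k, wdeg_le (c i) (a k) (X i k),
        forall i k, wdeg_le (c i) (d - a k) (Y i k) & Q = wedge X Y].

Lemma graded_wedge0 n (c : 'I_n -> nat) d r : graded_wedge c d r 0.
Proof.
exists 0, 0, (fun=> 0%N); split=> // [i k|i k|]; rewrite ?mxE ?wdeg_le0 //.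
by rewrite /wedge !mul0mx subrr.
Qed.

Lemma graded_wedge_add n (c : 'I_n -> nat) d r Q (x y : 'cV[{poly C}]_n) a :
  (a.*2 <= d)%N -> (forall i, wdeg_le (c i) a (x i 0)) ->
  (forall i, wdeg_le (c i) (d - a) (y i 0)) ->
  graded_wedge c d r (Q - wedge x y) -> graded_wedge c d r.+1 Q.
Proof.
move=> ad hx hy [X [Y [b [bd hX hY E]]]].
exists (row_mx x X : 'M[_]_(n, 1 + r)), (row_mx y Y : 'M[_]_(n, 1 + r)).
exists (fun k : 'I_(1 + r) => if fintype.split k is inr k' then b k' else a); split.
- by move=> k; case: splitP.
- by move=> i k; rewrite mxE; case: splitP => j _; rewrite ?ord1.
- by move=> i k; rewrite mxE; case: splitP => j _; rewrite ?ord1.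
by rewrite -[wedge _ _]/(wedge (row_mx x X) (row_mx y Y)) wedge_row_mx -E addrC subrK.
Qed.

Lemma graded_wedge_delete n (c : 'I_n.+1 -> nat) d r (Q : 'M[{poly C}]_n.+1) i :
  Q^T = - Q -> row i Q = 0 ->
  graded_wedge (c \o lift i) d r (mxsub (lift i) (lift i) Q) -> graded_wedge c d r Q.
Proof.
move=> Qskew Qi0 [X [Y [b [bd hX hY E]]]].
pose ext (Z : 'M[{poly C}]_(n, r)) : 'M[_]_(n.+1, r) :=
  \matrix_(j, k) if unlift i j is Some j' then Z j' k else 0.
exists (ext X), (ext Y), b; split=> //.
- by move=> j k; rewrite mxE; case: unliftP => [j' ->|_]; [exact: hX|exact: wdeg_le0].
- by move=> j k; rewrite mxE; case: unliftP => [j' ->|_]; [exact: hY|exact: wdeg_le0].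
have Qi k : Q i k = 0 by have := congr1 (fun M : 'rV_n.+1 => M 0 k) Qi0; rewrite !mxE.
have Qi' k : Q k i = 0.
  have := congr1 (fun M : 'M[_]_n.+1 => M i k) Qskew; rewrite !mxE => ->.
  by rewrite Qi oppr0.
apply/matrixP => j k; rewrite !mxE.
case: (unliftP i j) => [j' ->|->]; last first.
  by rewrite Qi !big1 ?subrr // => l _; rewrite !mxE unlift_none ?mul0r ?mulr0.
case: (unliftP i k) => [k' ->|->]; last first.
  by rewrite Qi' !big1 ?subrr // => l _; rewrite !mxE unlift_none ?mul0r ?mulr0.
have := congr1 (fun M : 'M[_]_n => M j' k') E; rewrite !mxE => ->.
by congr (_ - _); apply: eq_bigr => l _; rewrite !mxE !liftK.
Qed.

(** The measure r + n + (the sum of the d + 1 - c i) decreases in each step. A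
    zero row is deleted. A constant entry of the largest degree that the weights
    allow splits off one pair of columns, and the rank drops by two. Otherwise Q
    degenerates at some point (graded_degenerate), and a reduction there raises
    one weight; weights cannot exceed d, since the row is not zero. *)
Lemma graded_wedge_decomposition N n (c : 'I_n -> nat) d r (Q : 'M[{poly C}]_n) :
  (r + n + \sum_i (d.+1 - c i) <= N)%N ->
  Q^T = - Q -> (forall i j, wdeg_le (c i + c j) d (Q i j)) ->
  (\rank (map_mx tf Q) <= r.*2)%N -> graded_wedge c d r Q.
Proof.
elim: N n c r Q => [|N IH] n c r Q.
  rewrite leqn0 !addn_eq0 => /andP[/andP[_ /eqP n0] _] _ _ _.
  suff -> : Q = 0 by exact: graded_wedge0.
  by apply/matrixP => i; have := ltn_ord i; rewrite {2}n0.
move=> hN Qskew Qdeg rkQ.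
have [->|Q0] := eqVneq Q 0; first exact: graded_wedge0.
have Qs a b : Q a b = - Q b a.
  by have := congr1 (fun M : 'M[_]_n => M b a) Qskew; rewrite !mxE.
case: (pickP (fun i => row i Q == 0)) => [i /eqP Qi0|Qrow].
  case: n c Q i hN Qskew Qdeg rkQ {Q0 Qs} Qi0 => [|n] c Q i; first by case: i.
  move=> hN Qskew Qdeg rkQ Qi0; apply: (graded_wedge_delete Qskew Qi0); apply: IH.
  - rewrite -ltnS; apply: leq_trans hN; rewrite (bigD1_ord i) //=.
    by rewrite addnS addSn ltnS leq_add2l leq_addl.
  - by apply/matrixP => a b; have := congr1 (fun M : 'M[_]_n.+1 => M (lift i a) (lift i b)) Qskew; rewrite !mxE.
  - by move=> a b; rewrite mxE; exact: Qdeg.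
  - by apply: leq_trans rkQ; rewrite map_mxsub rank_mxsub.
case: r hN rkQ => [|r] hN rkQ.
  suff -> : Q = 0 by exact: graded_wedge0.
  have /eqP tQ : map_mx tf Q == 0 by rewrite -mxrank_eq0 -leqn0.
  apply/matrixP => a b; have := congr1 (fun M : 'M[_]_n => M a b) tQ; rewrite !mxE.
  by move/eqP; rewrite tofrac_eq0 => /eqP.
case: (pickP (fun ij : 'I_n * 'I_n => [&& size (Q ij.1 ij.2) == 1%N, (c ij.1 + c ij.2 == d)%N
    & (c ij.2 <= c ij.1)%N])) => [[i j] /= /and3P[/size_poly1P[q q0 Qij] /eqP cij cji]|nopivot].
  apply: (@graded_wedge_add _ _ _ _ _ (q^-1%:P *: col i Q) (col j Q) (c j)).
  - by rewrite -addnn -cij leq_add2r.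
  - move=> k; rewrite !mxE; apply: (@wdeg_leM _ 0 0); first exact: wdeg_leC.
    by apply: wdeg_le_weaken (Qdeg k i) _; rewrite -cij; lia.
  - by move=> k; rewrite !mxE; apply: wdeg_le_weaken (Qdeg k j) _; rewrite -cij; lia.
  set x := _ *: _; set y := col j Q.
  have hx k : wdeg_le (c k) (c j) (x k 0).
    rewrite !mxE; apply: (@wdeg_leM _ 0 0); first exact: wdeg_leC.
    by apply: wdeg_le_weaken (Qdeg k i) _; rewrite -cij; lia.
  have hy k : wdeg_le (c k) (c i) (y k 0).
    by rewrite !mxE; apply: wdeg_le_weaken (Qdeg k j) _; rewrite -cij; lia.
  apply: IH.
  - by rewrite -ltnS; apply: leq_trans hN; rewrite !addSn.
  - by rewrite linearB /= tr_wedge Qskew opprK opprB addrC.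
  - have cji' : (c j + c i)%N = d by rewrite addnC.
    have hxy a b := wdeg_leM (hx a) (hy b); rewrite cji' in hxy.
    move=> a b; rewrite mxE; apply: wdeg_leD => //.
    rewrite mxE wdeg_leN wedgeE big_ord1; apply: wdeg_leD => //.
    by rewrite wdeg_leN mulrC addnC.
  have qK : tf q%:P != 0 by rewrite tofrac_eq0 polyC_eq0.
  have Askew : (map_mx tf Q)^T = - map_mx tf Q by rewrite map_trmx Qskew map_mxN.
  have Aij : map_mx tf Q i j = tf q%:P by rewrite mxE Qij.
  have := @rank_skew_pivot K n (map_mx tf Q) i j two0K Askew; rewrite Aij => /(_ qK) h.
  have qi : tf q^-1%:P = (tf q%:P)^-1.
    by apply: (mulIf qK); rewrite mulVf // -rmorphM -polyCM mulVf // rmorph1.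
  have Ex : map_mx tf x = (tf q%:P)^-1 *: col i (map_mx tf Q).
    by apply/matrixP => a b; rewrite !mxE -qi -rmorphM.
  have Ey : map_mx tf y = col j (map_mx tf Q) by rewrite map_col.
  rewrite map_mxB map_wedge Ex Ey -2!ltnS -doubleS.
  by apply: leq_trans rkQ; apply: leq_trans h _.
have [i [y [z [pi [yi hy [hpi pi0] hz zdeg]]]]] : exists i y z pi, reducing_step d c Q i y z pi.
  apply/reducing_step_exists => //; apply: graded_degenerate => //.
    by case: n c Q {hN Qskew Qdeg rkQ Qs Qrow nopivot} Q0 => // c Q; rewrite [Q]flatmx0 eqxx.
  move=> i j sz cij; case: (leqP (c j) (c i)) => [cji|/ltnW cji].
    by have := nopivot (i, j); rewrite /= sz cij !eqxx cji.
  by have := nopivot (j, i); rewrite /= Qs size_polyN sz addnC cij !eqxx cji.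
have [Q2skew QE HG] := skew_elementary_reduction two0P Qskew yi hz.
move: Q2skew QE HG; set Q2 := (X in X^T = _); set G := (X in Q = X *m _ *m _).
set H := (X in X *m _ = _) => Q2skew QE HG.
have ci : (c i <= d)%N.
  have /rV0Pn[j] : row i Q != 0 by have /negbT := Qrow i.
  rewrite mxE => Qij; have := Qdeg i j; rewrite wdeg_leE (negPf Qij) /=.
  by move: Qij; rewrite -size_poly_gt0; move: (size _) => a; lia.
pose c' k := (c k + (k == i))%N.
have : graded_wedge c' d r.+1 Q2.
  apply: IH => //.
  - rewrite -ltnS; apply: leq_trans hN; rewrite ltn_add2l (bigD1 i) //= [X in (_ < X)%N](bigD1 i) //=.
    rewrite /c' eqxx addn1 -addSn; apply: leq_add; first by rewrite subSS ltn_subLR; lia.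
    by apply: leq_sum => k /negPf->; rewrite addn0.
  - move=> a b; rewrite mxE /c'.
    have [->|ai] := eqVneq a i; have [->|bi] := eqVneq b i; rewrite ?wdeg_le0 //.
    + by rewrite addn0 addn1 addSn; exact: zdeg.
    + by rewrite addn0 addn1 addnS addnC wdeg_leN; exact: zdeg.
    + by rewrite !addn0.
  apply: leq_trans rkQ.
  have -> : \rank (map_mx tf Q2) = \rank (map_mx tf (H *m Q *m H^T)).
    rewrite QE !mulmxA HG -(mulmxA _ G^T) -trmx_mul HG tr_scalar_mx mul_mx_scalar mul_scalar_mx scalerA.
    rewrite map_mxZ; apply/esym/mxrank_scale_nz.
    by rewrite tofrac_eq0; apply: mulf_neq0.
  by rewrite !map_mxM; apply: leq_trans (mxrankM_maxl _ _) (mxrankM_maxr _ _).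
have hG (e : 'I_r.+1 -> nat) (Z : 'M[{poly C}]_(n, r.+1)) :
    (forall k l, wdeg_le (c' k) (e l) (Z k l)) ->
    forall k l, wdeg_le (c k) (e l) ((G *m Z) k l).
  move=> hZ k l; rewrite mxE; apply: wdeg_le_sum => b _; rewrite mxE.
  have [->|ki] := eqVneq k i; last first.
    have [<-|_] := eqVneq k b; last by rewrite mul0r wdeg_le0.
    by rewrite mul1r; have := hZ k l; rewrite /c' (negPf ki) addn0.
  have [->|bi] := eqVneq b i.
    by apply: wdeg_le_weaken (wdeg_leM hpi (hZ i l)) _; rewrite /c' eqxx; lia.
  rewrite mulNr wdeg_leN; apply: wdeg_le_weaken (wdeg_leM (hy b) (hZ b l)) _.
  by rewrite /c' (negPf bi); lia.
case=> X [Y [a [ha hX hY E]]]; exists (G *m X), (G *m Y), a; split=> //.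
- exact: hG.
- exact: (hG (fun k => (d - a k)%N)).
by rewrite wedge_mull -E.
Qed.
End WedgeDecomposition.

Section Balancing.
Variable C : closedFieldType.

(** Divide the long column y of a pair (x, y) by 'X^s, as y = v + u 'X^s. The
    columns x + e u and v - e^-1 'X^s x have degree at most h. In their wedge, the
    term of order e^-1 vanishes, because x ^ 'X^s x = 0, and the terms of order 0
    are x ^ v + x ^ 'X^s u = x ^ y. *)
Lemma graded_wedge_balance m h r (Q : 'M[{poly C}]_m) :
  graded_wedge (fun=> 0%N) h.*2 r Q ->
  exists E : 'M[{poly C}]_m, forall e, e != 0 ->
  exists X Y : 'M[{poly C}]_(m, r),
    [/\ forall i k, (size (X i k) <= h.+1)%N, forall i k, (size (Y i k) <= h.+1)%N
      & wedge X Y = Q + e%:P *: E].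
Proof.
case=> X [Y [a [ah hX hY QE]]].
have hX' i k : (size (X i k) <= (a k).+1)%N by have := hX i k; rewrite /wdeg_le mulr1.
have hY' i k : (size (Y i k) <= (h.*2 - a k).+1)%N by have := hY i k; rewrite /wdeg_le mulr1.
have ah' k : (a k <= h)%N by rewrite -leq_double.
(* U and V are the quotients and the remainders of the columns of Y by 'X^s. *)
pose s k := (h - a k)%N.
pose U : 'M[{poly C}]_(m, r) := \matrix_(i, k) drop_poly (s k) (Y i k).
pose V : 'M[{poly C}]_(m, r) := \matrix_(i, k) take_poly (s k) (Y i k).
pose D : 'M[{poly C}]_r := diag_mx (\row_k 'X^(s k)).
have YE : Y = V + U *m D.
  by apply/matrixP => i k; rewrite mxE mul_mx_diag !mxE poly_take_drop.
have DT : D^T = D by rewrite tr_diag_mx.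
exists (wedge U V) => e e0; exists (X + e%:P *: U), (V - e^-1%:P *: (X *m D)); split.
- move=> i k; rewrite !mxE mul_polyC.
  apply: leq_trans (size_polyD _ _) _; rewrite geq_max; apply/andP; split.
    by apply: leq_trans (hX' i k) _; rewrite ltnS.
  apply: leq_trans (size_scale_leq _ _) _; rewrite size_drop_poly.
  have := hY' i k; have := ah' k; rewrite /s; move: (size _) => b; lia.
- move=> i k; rewrite 4!mxE; apply: leq_trans (size_polyD _ _) _.
  rewrite geq_max; apply/andP; split.
    by apply: leq_trans (size_take_poly _ _) _; rewrite /s; lia.
  rewrite size_polyN mul_polyC; apply: leq_trans (size_scale_leq _ _) _.
  rewrite mul_mx_diag !mxE; apply: leq_trans (size_polyMleq _ _) _.
  rewrite size_polyXn; have := hX' i k; have := ah' k; rewrite /s; move: (size _) => b; lia.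
rewrite QE YE wedgeDl !wedgeDr !wedgeNr !wedgeZl !wedgeZr.
have -> : wedge X (X *m D) = 0 by rewrite /wedge trmx_mul DT mulmxA subrr.
rewrite (wedge_symr U X DT) (wedgeC _ X) scaler0 subr0 scalerN scalerN scalerA -polyCM mulfV // scale1r.
by rewrite opprK addrA addrAC.
Qed.
End Balancing.
(** * Sylvester matrices *)
Section Sylvester.
Variable F : fieldType.

Definition polyrow m k (X : 'M[F]_(m, k)) : 'rV[{poly F}]_m := \row_i rVpoly (row i X).
Definition coefmx m k (v : 'rV[{poly F}]_m) : 'M[F]_(m, k) := \matrix_(i, j) (v 0 i)`_j.

Lemma polyrowK m k : cancel (@polyrow m k) (@coefmx m k).
Proof. by move=> X; apply/matrixP => i j; rewrite !mxE coef_rVpoly_ord mxE. Qed.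

Lemma coefmxK m k (v : 'rV[{poly F}]_m) : (forall i, (size (v 0%R i) <= k)%N) ->
  polyrow (coefmx k v) = v.
Proof.
move=> hv; apply/rowP => i; rewrite mxE; apply/polyP => j; rewrite coef_rVpoly.
case: insubP => [j' _ <-|]; first by rewrite !mxE.
by rewrite -leqNgt => kj; rewrite nth_default //; apply: leq_trans (hv i) kj.
Qed.

Lemma size_polyrow m k (X : 'M[F]_(m, k)) i : (size (polyrow X 0%R i) <= k)%N.
Proof. by rewrite mxE; apply: size_poly. Qed.

Lemma polyrow_is_linear m k : linear_for (fun a (v : 'rV[{poly F}]_m) => a%:P *: v) (@polyrow m k).
Proof.
by move=> a X Y; apply/rowP => i; rewrite !mxE linearP /= linearP /= mul_polyC.
Qed.

Lemma coefmxZ m k a (v : 'rV[{poly F}]_m) : coefmx k (a%:P *: v) = a *: coefmx k v.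
Proof. by apply/matrixP => i j; rewrite !mxE coefCM. Qed.

Lemma coefmxD m k (v w : 'rV[{poly F}]_m) : coefmx k (v + w) = coefmx k v + coefmx k w.
Proof. by apply/matrixP => i j; rewrite !mxE coefD. Qed.

Definition convmx m a k l (B : 'M[{poly F}]_(m, a)) (X : 'M[F]_(m, k)) : 'M[F]_(a, l) :=
  coefmx l (polyrow X *m B).

Lemma convmx_is_linear m a k l (B : 'M[{poly F}]_(m, a)) : linear (@convmx m a k l B).
Proof.
move=> x X Y; rewrite /convmx polyrow_is_linear mulmxDl -scalemxAl.
by rewrite coefmxD coefmxZ.
Qed.

HB.instance Definition _ m a k l B :=
  GRing.isLinear.Build F 'M[F]_(m, k) 'M[F]_(a, l) _ (@convmx m a k l B) (@convmx_is_linear m a k l B).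

(** The map v |-> v B from vectors with k coefficients per entry to vectors with
    l coefficients per entry; no coefficient is lost when l = k + deg B. *)
Definition sylvester m a k l (B : 'M[{poly F}]_(m, a)) : 'M[F]_(m * k, a * l) :=
  lin_mx (@convmx m a k l B).

Lemma mul_sylvester m a k l (B : 'M[{poly F}]_(m, a)) (v : 'rV[{poly F}]_m) :
  (forall i, (size (v 0%R i) <= k)%N) ->
  mxvec (coefmx k v) *m sylvester k l B = mxvec (coefmx l (v *m B)).
Proof. by move=> hv; rewrite mul_vec_lin /= /convmx coefmxK. Qed.

Lemma sylvesterD m a k l (B0 B1 : 'M[{poly F}]_(m, a)) t :
  sylvester k l (B0 + t%:P *: B1) = sylvester k l B0 + t *: sylvester k l B1.
Proof.
apply/row_matrixP => i; rewrite !rowE -[delta_mx 0 i]vec_mxK.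
rewrite mulmxDr -scalemxAr !mul_vec_lin /= -linearZ -linearD /=; congr (mxvec _).
by rewrite /convmx mulmxDr -scalemxAr coefmxD coefmxZ.
Qed.

End Sylvester.

Section OpenOnLines.
Variable F : fieldType.

(** For a right inverse R at t0, the determinant of (A0 + t A1) R is a polynomial
    in t which takes the value 1 at t0. *)
Lemma row_free_line p q (A0 A1 : 'M[F]_(p, q)) t0 : row_free (A0 + t0 *: A1)%R ->
  exists2 f : {poly F}, f != 0 & forall t, f.[t] != 0 -> row_free (A0 + t *: A1)%R.
Proof.
case/row_freeP => R hR.
pose M := map_mx polyC (A0 *m R) + 'X *: map_mx polyC (A1 *m R).
have Mt t : map_mx (horner_eval t) M = (A0 + t *: A1) *m R.
  rewrite mulmxDl -scalemxAl /M; move: (A0 *m R) (A1 *m R) => U V.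
  by apply/matrixP => i j; rewrite !mxE /horner_eval hornerD hornerM hornerX !hornerC.
have dt t : (\det M).[t] = \det ((A0 + t *: A1) *m R).
  by rewrite -Mt det_map_mx.
exists (\det M) => [|t].
  by apply: contraTneq isT => h; have := dt t0; rewrite h horner0 hR det1 => /eqP; rewrite eq_sym oner_eq0.
rewrite dt => h; apply/row_freeP; exists (R *m invmx ((A0 + t *: A1) *m R)).
by rewrite mulmxA mulmxV // unitmxE unitfE.
Qed.

Lemma row_full_line p q (A0 A1 : 'M[F]_(p, q)) t0 : row_full (A0 + t0 *: A1)%R ->
  exists2 f : {poly F}, f != 0 & forall t, f.[t] != 0 -> row_full (A0 + t *: A1)%R.
Proof.
have tr t : row_full (A0 + t *: A1)%R = row_free (A0^T + t *: A1^T).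
  have -> : A0^T + t *: A1^T = (A0 + t *: A1)^T by rewrite linearD linearZ.
  by rewrite /row_full /row_free mxrank_tr.
by rewrite tr => /row_free_line[f f0 hf]; exists f => // t ft; rewrite tr hf.
Qed.
End OpenOnLines.

(** * Zigzag matrices, whose Sylvester matrices have maximal rank *)
Section Zigzag.
Variables (F : fieldType) (a m k h : nat).
Hypothesis k0 : (0 < k)%N.
Local Notation L := (k + h)%N.

(** Arrange the monomials 'X^u e_i with u < L = k + h in one line, those of e_0
    first, then those of e_1, and so on, and cut this line into blocks of length
    k. The multiples 'X^l (row j), l < k, are designed to generate the j-th
    block, which starts at 'X^s e_q. If s <= h, the block lies in the part of
    e_q and row j is its first monomial. Otherwise the block straddles two
    parts and row j is 'X^h e_q + e_(q+1): each multiple of this row is the sum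
    of one monomial of the block and of one monomial of another block. *)
Definition zigzag : 'M[{poly F}]_(m, a) :=
  \matrix_(j, i) (let q := ((j * k) %/ L)%N in let s := ((j * k) %% L)%N in
   (i == q :> nat)%:R * 'X^(minn s h) + ((i == q.+1 :> nat) && (h < s)%N)%:R).

Let e (i : nat) : 'rV[{poly F}]_a := \row_i' (i' == i :> nat)%:R.

Lemma zigzag_row (j : 'I_m) : row j zigzag =
  'X^(minn ((j * k) %% L) h) *: e ((j * k) %/ L) +
  (h < (j * k) %% L)%N%:R *: e ((j * k) %/ L).+1.
Proof.
apply/rowP => i; rewrite !mxE mulrC; congr (_ + _).
by rewrite -natrM mulnb andbC.
Qed.

Variable P : 'rV[{poly F}]_a -> Prop.
Hypothesis P0 : P 0.
Hypothesis PB : forall x y, P x -> P y -> P (x - y).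
Hypothesis Prow : forall (j : 'I_m) l, (l < k)%N -> P ('X^l *: row j zigzag).
Hypothesis Pextra : forall i u, (m * k <= i * L + u)%N -> P ('X^u *: e i).

(** The monomial 'X^u e_i lies in the head of a straddling block, the portion in which
    the block meets the part of e_i where it starts. *)
Let upper i u := let j := ((i * L + u) %/ k)%N in
  ((j * k) %/ L == i)%N && (h < (j * k) %% L)%N.

Lemma zigzag_block i u (j := ((i * L + u) %/ k)%N) (q := ((j * k) %/ L)%N)
    (s := ((j * k) %% L)%N) : (u < L)%N ->
  [/\ j * k <= i * L + u, i * L + u < j * k + k, j * k = q * L + s, s < L &
      (q = i /\ s <= u) \/ (q.+1 = i /\ u + L < s + k)]%N.
Proof.
move=> uL; have L0 : (0 < L)%N by rewrite addn_gt0 k0.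
have h1 : (j * k <= i * L + u)%N by exact: leq_trunc_div.
have h2 : (i * L + u < j * k + k)%N by have := ltn_ceil (i * L + u) k0; rewrite mulSnr.
have h3 : (j * k = q * L + s)%N by exact: divn_eq.
have h4 : (s < L)%N by rewrite ltn_mod.
split=> //; move: h1 h2; rewrite h3; clearbody q s => h1 h2.
have qi : (q <= i)%N.
  by rewrite -ltnS -(ltn_pmul2r L0) mulSn; lia.
have iq : (i <= q.+1)%N.
  by rewrite -ltnS -(ltn_pmul2r L0) !mulSn; lia.
move: iq; rewrite leq_eqVlt => /predU1P[iq|].
  by right; split=> //; move: h2; rewrite iq mulSn; lia.
rewrite ltnS => iq; have E : q = i by apply/eqP; rewrite eqn_leq qi.
by left; split=> //; move: h1; rewrite E leq_add2l.
Qed.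

Let block_lt i u : (i * L + u < m * k)%N -> ((i * L + u) %/ k < m)%N.
Proof. by move=> h1; rewrite ltn_divLR. Qed.

(** A monomial in the tail of a straddling block is, up to sign and modulo
    the row of this block, a monomial of the previous part, which lies in an
    earlier block but not in its head: induction on i. *)
Lemma zigzag_nonupper i u : (u < L)%N -> ~~ upper i u -> P ('X^u *: e i).
Proof.
elim/ltn_ind: i u => i IH u uL; rewrite /upper.
have [] := zigzag_block i uL; have jm := @block_lt i u.
set j := ((i * L + u) %/ k)%N in jm *.
set q := ((j * k) %/ L)%N; set s := ((j * k) %% L)%N => hj1 hj2 hjk sL hq.
have [/Pextra//|/jm {}jm] := leqP (m * k) (i * L + u).
case: hq => [[qi su]|[qi su]].
  rewrite qi eqxx /= -leqNgt => sh.
  have ul : (u - s < k)%N by move: hj2; rewrite hjk qi; lia.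
  have := Prow (Ordinal jm) ul; rewrite zigzag_row /= -/q -/s (minn_idPl sh).
  by rewrite ltnNge sh scale0r addr0 scalerA -exprD subnK // qi.
move=> _; have hs : (h + u < s)%N by move: su; lia.
have uk : (u < k)%N by lia.
have := Prow (Ordinal jm) uk; rewrite zigzag_row /= -/q -/s.
have -> : minn s h = h by apply/minn_idPr; lia.
have -> : (h < s)%N by lia.
rewrite scale1r qi scalerDr scalerA -exprD addrC => hP.
have hq' : P ('X^(u + h) *: e q).
  apply: IH; [by rewrite -qi|by lia|].
  have uL' : (u + h < L)%N by lia.
  rewrite /upper; have [] := zigzag_block q uL'.
  set j' := ((q * L + (u + h)) %/ k)%N.
  set q' := ((j' * k) %/ L)%N; set s' := ((j' * k) %% L)%N => h1 h2 h3 h4 _.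
  apply/negP => /andP[/eqP q'q hs'].
  have j'j : (j' < j)%N by rewrite -(ltn_pmul2r k0) hjk; lia.
  have := leq_mul2r k j'.+1 j; rewrite j'j orbT mulSn h3 hjk q'q; lia.
by have := PB hP hq'; rewrite addrK.
Qed.

(** A monomial in the head of a straddling block is, up to sign and modulo
    the row of this block, a monomial of the next part: descending induction on
    i. *)
Lemma zigzag_spans i u : (i < a)%N -> (u < L)%N -> P ('X^u *: e i).
Proof.
move: {-1}(a - i)%N (leqnn (a - i)) => n; elim: n i u => [|n IH] i u.
  by move=> h1 h2; exfalso; lia.
move=> hn ia uL; have [|] := boolP (upper i u); last exact: zigzag_nonupper.
rewrite /upper; have [] := zigzag_block i uL; have jm := @block_lt i u.
set j := ((i * L + u) %/ k)%N in jm *.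
set q := ((j * k) %/ L)%N; set s := ((j * k) %% L)%N => hj1 hj2 hjk sL hq.
case/andP=> /eqP qi hs.
have [/Pextra//|/jm {}jm] := leqP (m * k) (i * L + u).
have {hq} su : (s <= u)%N by case: hq => [[]//|[]]; rewrite qi; lia.
have uk : (u - h < k)%N by lia.
have := Prow (Ordinal jm) uk; rewrite zigzag_row /= -/q -/s.
have -> : minn s h = h by apply/minn_idPr; lia.
rewrite hs scale1r qi scalerDr scalerA -exprD subnK; last by lia.
move=> hP; suff hi : P ('X^(u - h) *: e i.+1) by have := PB hP hi; rewrite addrK.
have [ia'|ai] := ltnP i.+1 a; first by apply: IH => //; lia.
have -> : e i.+1 = 0; last by rewrite scaler0.
apply/rowP => i'; rewrite !mxE; case: eqP => // E.
by have := ltn_ord i'; rewrite E ltnNge ai.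
Qed.

End Zigzag.

Section ZigzagRank.
Variables (F : fieldType) (a m k h : nat).
Hypothesis k0 : (0 < k)%N.
Local Notation L := (k + h)%N.
Let Z : 'M[{poly F}]_(m, a) := zigzag F a m k h.

(** Together with the monomials of the blocks that have no row in the matrix,
    the image is the whole space, by zigzag_spans; there are a L - m k of those
    monomials, or none if m k exceeds a L. *)
Lemma zigzag_rank : (minn (m * k) (a * L) <= \rank (sylvester k L Z))%N.
Proof.
set S := sylvester k L Z.
pose E : 'M[F]_(a * L - m * k, a * L) := \matrix_x mxvec (\matrix_(i, u) (i * L + u == m * k + x)%N%:R).
suff full : (1%:M <= S + E)%MS.
  have := mxrankS full; rewrite mxrank1 => h1.
  have := leq_trans h1 (mxrank_adds_leqif S E).1; have := rank_leq_row E; lia.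
pose P (w : 'rV[{poly F}]_a) := (mxvec (coefmx L w) <= S + E)%MS.
have P0 : P 0 by rewrite /P (_ : coefmx L 0 = 0) ?linear0 ?sub0mx //; apply/matrixP => i j; rewrite !mxE coef0.
have PB x y : P x -> P y -> P (x - y).
  move=> hx hy; rewrite /P -scaleN1r -(rmorphN1 polyC) coefmxD coefmxZ scaleN1r linearB /=.
  by apply: addmx_sub => //; rewrite eqmx_opp.
have Prow (j : 'I_m) l : (l < k)%N -> P ('X^l *: row j Z).
  move=> lk; rewrite /P.
  have -> : 'X^l *: row j Z = ('X^l *: delta_mx 0 j) *m Z by rewrite -scalemxAl -rowE.
  rewrite -(@mul_sylvester F m a k); last first.
    move=> i; rewrite !mxE; case: (_ && _); last by rewrite mulr0 size_poly0.
    by rewrite mulr1 size_polyXn.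
  by apply: submx_trans (submxMl _ _) (addsmxSl _ _).
have ce i u : mxvec (coefmx L ('X^u *: \row_(i' < a) (i' == i :> nat)%:R : 'rV[{poly F}]_a)) =
   mxvec (\matrix_(i', u') ((i' == i :> nat) && (u' == u :> nat))%:R).
  congr (mxvec _); apply/matrixP => i' u'; rewrite !mxE.
  by case: eqP => _; rewrite ?mulr1 ?mulr0 ?coef0 // coefXn.
have Pextra i u : (m * k <= i * L + u)%N -> P ('X^u *: \row_(i' < a) (i' == i :> nat)%:R).
  move=> hmk; rewrite /P ce.
  have [/andP[ia uL]|out] := boolP ((i < a) && (u < L))%N; last first.
    rewrite (_ : (\matrix_(_,_) _) = 0) ?linear0 ?sub0mx //; apply/matrixP => i' u'; rewrite !mxE.
    case: andP => // -[/eqP Ei /eqP Eu]; move: out.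
    by rewrite -Ei -Eu !ltn_ord.
  have hx : (i * L + u - m * k < a * L - m * k)%N.
    have : (i.+1 * L <= a * L)%N by rewrite leq_mul2r ia orbT.
    rewrite mulSn; lia.
  apply: submx_trans (addsmxSr _ _); apply: (submx_trans _ (row_sub (Ordinal hx) E)).
  rewrite rowK (_ : (\matrix_(_,_) _) = \matrix_(i', u') (i' * L + u' == m * k + (i * L + u - m * k))%N%:R) //.
  apply/matrixP => i' u'; rewrite !mxE subnKC //; congr (_%:R); congr nat_of_bool; apply/idP/idP.
    by case/andP => /eqP-> /eqP->.
  move=> /eqP h1; have h2 := congr1 (divn^~ L) h1; have h3 := congr1 (modn^~ L) h1.
  move: h2 h3; rewrite !divnMDl ?addn_gt0 ?k0 // !modnMDl !divn_small // !addn0 !modn_small // => -> ->.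
  by rewrite !eqxx.
apply/row_subP => x; rewrite row1; case/mxvec_indexP: x => i u.
have := @zigzag_spans F a m k h k0 P P0 PB Prow Pextra i u (ltn_ord i) (ltn_ord u).
rewrite /P ce; congr (_ <= _)%MS; rewrite -mxvec_delta; congr mxvec.
by apply/matrixP => i' u'; rewrite !mxE.
Qed.

Lemma zigzag_row_free : (m * k <= a * L)%N -> row_free (sylvester k L Z).
Proof.
by move=> hm; rewrite -row_leq_rank; apply: leq_trans zigzag_rank; rewrite (minn_idPl hm).
Qed.

Lemma zigzag_row_full : (a * L <= m * k)%N -> row_full (sylvester k L Z).
Proof.
by move=> hm; rewrite -col_leq_rank; apply: leq_trans zigzag_rank; rewrite (minn_idPr hm).
Qed.

Lemma size_zigzag i j : (size (Z i j) <= h.+1)%N.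
Proof.
rewrite mxE; set s := ((i * k) %% L)%N; apply: leq_trans (size_polyD _ _) _; rewrite geq_max.
apply/andP; split; last by case: (_ && _); rewrite ?size_poly1 ?size_poly0.
case: (_ == _); last by rewrite mul0r size_poly0.
by rewrite mul1r size_polyXn ltnS geq_minr.
Qed.
End ZigzagRank.

(** * Spaces of null vectors of bounded degree *)
Section SylvesterMeaning.
Variables (F : fieldType) (m a h : nat) (B : 'M[{poly F}]_(m, a)).
Hypothesis sB : forall i j, (size (B i j) <= h.+1)%N.

Lemma size_mulmx_poly k (v : 'rV[{poly F}]_m) : (forall i, (size (v 0%R i) <= k)%N) ->
  forall j, (size ((v *m B) 0%R j) <= k + h)%N.
Proof.
move=> hv j; rewrite mxE; apply: leq_trans (size_sum _ _ _) _; apply/bigmax_leqP => i _.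
apply: leq_trans (size_polyMleq _ _) _; have := hv i; have := sB i j.
by move: (size _) (size (v _ _)) => x y; lia.
Qed.

Lemma sylvester_surj k : row_full (sylvester k (k + h) B) ->
  forall w : 'rV[{poly F}]_a, (forall j, (size (w 0%R j) <= k + h)%N) ->
  exists2 v : 'rV[{poly F}]_m, (forall i, (size (v 0%R i) <= k)%N) & v *m B = w.
Proof.
move=> full w sw; have /submxP[u Eu] := submx_full (mxvec (coefmx (k + h) w)) full.
exists (polyrow (vec_mx u)); first by move=> i; apply: size_polyrow.
have := @mul_sylvester _ _ _ k (k + h) B (polyrow (vec_mx u)) (fun i => size_polyrow _ i).
rewrite polyrowK vec_mxK -Eu => /(can_inj mxvecK) E.
rewrite -[RHS](@coefmxK _ _ (k + h)) // E coefmxK //.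
by apply: size_mulmx_poly => i; apply: size_polyrow.
Qed.

Lemma surj_sylvester k :
  (forall w : 'rV[{poly F}]_a, (forall j, (size (w 0%R j) <= k + h)%N) ->
  exists2 v : 'rV[{poly F}]_m, (forall i, (size (v 0%R i) <= k)%N) & v *m B = w) ->
  row_full (sylvester k (k + h) B).
Proof.
move=> surj; rewrite -sub1mx; apply/row_subP => x; rewrite row1 -[delta_mx 0 x]vec_mxK.
have [v sv vB] := surj (polyrow (vec_mx (delta_mx 0 x))) (fun i => size_polyrow _ i).
by apply/submxP; exists (mxvec (coefmx k v)); rewrite mul_sylvester // vB polyrowK.
Qed.

Lemma sylvester_inj k (v : 'rV[{poly F}]_m) : row_free (sylvester k (k + h) B) ->
  (forall i, (size (v 0%R i) <= k)%N) -> v *m B = 0 -> v = 0.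
Proof.
move=> free sv vB; rewrite -[v](@coefmxK _ _ k) //.
suff -> : coefmx k v = 0 by apply/rowP => i; rewrite !mxE linear0 linear0.
apply: (can_inj mxvecK); rewrite linear0; apply: (row_free_inj free).
rewrite mul0mx mul_sylvester // vB; apply/eqP; rewrite mxvec_eq0; apply/eqP.
by apply/matrixP => i j; rewrite !mxE coef0.
Qed.

Lemma left_inverse_of_full k : (0 < k)%N -> row_full (sylvester k (k + h) B) ->
  exists G : 'M[{poly F}]_(a, m), G *m B = 1%:M.
Proof.
move=> k0 full; have surj := sylvester_surj full.
have ex i : exists v : 'rV[{poly F}]_m, v *m B == delta_mx 0 i.
  have [|v _ vB] := surj (delta_mx 0 i); last by exists v; apply/eqP.
  move=> j; rewrite mxE; case: (_ && _); rewrite ?size_poly1 ?size_poly0 //; lia.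
exists (\matrix_i xchoose (ex i)); apply/row_matrixP => i.
by rewrite row_mul rowK row1; apply/eqP/(xchooseP (ex i)).
Qed.

Lemma sylvester_full_succ k : row_full (sylvester k (k + h) B) -> (0 < k)%N ->
  row_full (sylvester k.+1 (k.+1 + h) B).
Proof.
move=> full k0; apply: surj_sylvester => w sw.
have [|v0 sv0 v0B] := sylvester_surj full (w := \row_j take_poly 1 (w 0 j)).
  by move=> j; rewrite mxE; apply: leq_trans (size_take_poly _ _) _; lia.
have [|v1 sv1 v1B] := sylvester_surj full (w := \row_j drop_poly 1 (w 0 j)).
  by move=> j; rewrite mxE size_drop_poly; have := sw j; move: (size _) => x; lia.
exists (v0 + 'X *: v1).
  move=> i; rewrite !mxE; apply: leq_trans (size_polyD _ _) _; rewrite geq_max.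
  rewrite (leq_trans (sv0 i)) //= mulrC; apply: leq_trans (size_polyMleq _ _) _.
  by rewrite size_polyX; have := sv1 i; move: (size _) => x; lia.
rewrite mulmxDl -scalemxAl v0B v1B; apply/rowP => j; rewrite !mxE.
by rewrite -[RHS](poly_take_drop 1) expr1 mulrC.
Qed.

(** Independence of the rows with respect to constant coefficients only. *)
Definition const_independent q (Z : 'M[{poly F}]_(q, m)) :=
  forall u : 'rV[F]_q, map_mx polyC u *m Z = 0 -> u = 0.

Definition flat_coefs k q (Z : 'M[{poly F}]_(q, m)) : 'M[F]_(q, m * k) :=
  \matrix_i mxvec (coefmx k (row i Z)).

Lemma flat_coefs_mul k p q (U : 'M[F]_(p, q)) (Z : 'M[{poly F}]_(q, m)) :
  flat_coefs k (map_mx polyC U *m Z) = U *m flat_coefs k Z.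
Proof.
apply/matrixP => i j; case/mxvec_indexP: j => j l; rewrite !mxE mxvecE !mxE coef_sum.
by apply: eq_bigr => x _; rewrite !mxE mxvecE !mxE coefCM.
Qed.

Lemma flat_coefs_sylvester k q (Z : 'M[{poly F}]_(q, m)) : (forall i j, (size (Z i j) <= k)%N) ->
  Z *m B = 0 -> flat_coefs k Z *m sylvester k (k + h) B = 0.
Proof.
move=> sZ ZB; apply/row_matrixP => i; rewrite row_mul rowK mul_sylvester.
  rewrite -row_mul ZB !row0; apply/eqP; rewrite mxvec_eq0; apply/eqP.
  by apply/matrixP => x y; rewrite !mxE coef0.
by move=> j; rewrite mxE.
Qed.

Lemma flat_coefs_inj k q (Z : 'M[{poly F}]_(q, m)) : (forall i j, (size (Z i j) <= k)%N) ->
  flat_coefs k Z = 0 -> Z = 0.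
Proof.
move=> sZ Z0; apply/row_matrixP => i; rewrite row0 -[LHS](@coefmxK _ _ k); last by move=> j; rewrite mxE.
have := congr1 (row i) Z0; rewrite rowK row0 => /eqP; rewrite mxvec_eq0 => /eqP->.
by apply/rowP => x; rewrite !mxE linear0 linear0.
Qed.

Lemma size_mul_const k p q (U : 'M[F]_(p, q)) (Z : 'M[{poly F}]_(q, m)) :
  (forall i j, (size (Z i j) <= k)%N) -> forall i j, (size ((map_mx polyC U *m Z) i j) <= k)%N.
Proof.
move=> sZ i j; rewrite mxE; apply: leq_trans (size_sum _ _ _) _; apply/bigmax_leqP => x _.
by rewrite mxE mul_polyC; apply: leq_trans (size_scale_leq _ _) (sZ _ _).
Qed.

Lemma const_independent_bound k q (Z : 'M[{poly F}]_(q, m)) : (forall i j, (size (Z i j) <= k)%N) ->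
  Z *m B = 0 -> const_independent Z -> (q <= m * k - \rank (sylvester k (k + h) B))%N.
Proof.
move=> sZ ZB Zi; rewrite -mxrank_ker.
have free : row_free (flat_coefs k Z).
  rewrite -kermx_eq0; apply/eqP/row_matrixP => i; rewrite row0; apply: Zi.
  apply: (@flat_coefs_inj k); first exact: size_mul_const.
  by rewrite flat_coefs_mul -row_mul mulmx_ker row0.
by rewrite -(eqP free); apply/mxrankS/sub_kermxP/flat_coefs_sylvester.
Qed.

(** A basis, over the constants, of the space of null vectors with at most k
    coefficients per entry. *)
Lemma kernel_family k (q := (m * k - \rank (sylvester k (k + h) B))%N) :
  exists Z : 'M[{poly F}]_(q, m), [/\ forall i j, (size (Z i j) <= k)%N, Z *m B = 0, const_independent Z &
   forall v : 'rV[{poly F}]_m, (forall j, (size (v 0%R j) <= k)%N) -> v *m B = 0 ->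
     exists u : 'rV[F]_q, v = map_mx polyC u *m Z].
Proof.
rewrite /q -mxrank_ker {q}; set S := sylvester _ _ _; set N := row_base (kermx S).
exists (\matrix_i polyrow (vec_mx (row i N))); set Z := \matrix_i _.
have sZ i j : (size (Z i j) <= k)%N by rewrite mxE size_polyrow.
have vZ : flat_coefs k Z = N by apply/row_matrixP => i; rewrite rowK rowK polyrowK vec_mxK.
have NS : N *m S = 0 by apply/sub_kermxP; rewrite eq_row_base.
split=> //.
- apply/row_matrixP => i; rewrite row0 row_mul rowK; set v := polyrow _.
  have := @mul_sylvester _ _ _ k (k + h) B v (fun i => size_polyrow _ i).
  rewrite polyrowK vec_mxK -row_mul NS row0 => /esym/eqP; rewrite mxvec_eq0 => /eqP E.
  rewrite -[LHS](@coefmxK _ _ (k + h)); last by apply: size_mulmx_poly => x; apply: size_polyrow.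
  by rewrite E; apply/rowP => j; rewrite !mxE !linear0.
- move=> u uZ; have : u *m N = 0 by rewrite -vZ -flat_coefs_mul uZ; apply/row_matrixP => i; rewrite rowK !row0; apply/eqP; rewrite mxvec_eq0; apply/eqP/matrixP => x y; rewrite !mxE coef0.
  by move/eqP; rewrite mulmx_free_eq0 ?row_base_free // => /eqP.
move=> v sv vB; have : (flat_coefs k v <= N)%MS.
  rewrite eq_row_base; apply/sub_kermxP/flat_coefs_sylvester => // i j.
  by rewrite ord1.
case/submxP => u Eu; exists u; apply/eqP; rewrite -subr_eq0; apply/eqP.
apply: (@flat_coefs_inj k).
  move=> i j; rewrite ord1 !mxE; apply: leq_trans (size_polyD _ _) _; rewrite size_polyN geq_max sv /=.
  by have := size_mul_const u sZ 0 j; rewrite mxE.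
apply/row_matrixP => i; rewrite rowK row0 linearB /=.
have : flat_coefs k v = flat_coefs k (map_mx polyC u *m Z) by rewrite flat_coefs_mul vZ.
move=> /(congr1 (row i)); rewrite !rowK => /(can_inj mxvecK) E.
apply/eqP; rewrite mxvec_eq0; apply/eqP/matrixP => x y.
have := congr1 (fun M : 'M[_]_(m,k) => M x y) E; rewrite !mxE coefB => ->.
by rewrite subrr.
Qed.

End SylvesterMeaning.

Section LeadingRows.
Variable F : fieldType.
Local Notation K := {fraction {poly F}}.
Local Notation tf := (@tofrac {poly F}).

Definition coef_rows e q m (Z : 'M[{poly F}]_(q, m)) : 'M[F]_(q, m) := map_mx (coefp e) Z.

Lemma coef_rows_mul e p q m (U : 'M[F]_(p, q)) (Z : 'M[{poly F}]_(q, m)) :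
  coef_rows e (map_mx polyC U *m Z) = U *m coef_rows e Z.
Proof.
apply/matrixP => i j; rewrite !mxE /coefp coef_sum.
by apply: eq_bigr => x _; rewrite !mxE coefCM.
Qed.

(** If R is a constant right inverse of the matrix of top coefficients of Z, then
    det (Z R) has top coefficient 1. *)
Lemma leading_rows_free e q m (Z : 'M[{poly F}]_(q, m)) :
  (forall i j, (size (Z i j) <= e.+1)%N) -> row_free (coef_rows e Z) ->
  row_free (map_mx tf Z).
Proof.
move=> sZ /row_freeP[R hR].
have s' i j : (size ((Z *m map_mx polyC R) i j) <= e.+1)%N.
  rewrite mxE; apply: leq_trans (size_sum _ _ _) _; apply/bigmax_leqP => x _.
  by rewrite mxE mulrC mul_polyC; apply: leq_trans (size_scale_leq _ _) (sZ _ _).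
have top := det_coef_top s'.
have top1 : \matrix_(i, j) ((Z *m map_mx polyC R) i j)`_e = 1%:M.
  rewrite -hR; apply/matrixP => i j; rewrite !mxE coef_sum; apply: eq_bigr => x _.
  by rewrite !mxE coefMC.
rewrite top1 det1 in top.
have D0 : \det (Z *m map_mx polyC R) != 0.
  by apply: contra_eq_neq top => ->; rewrite coef0 eq_sym oner_eq0.
have U : map_mx tf (Z *m map_mx polyC R) \in unitmx.
  by rewrite unitmxE det_map_mx unitfE tofrac_eq0.
apply/row_freeP; exists (map_mx tf (map_mx polyC R) *m invmx (map_mx tf (Z *m map_mx polyC R))).
by rewrite mulmxA -map_mxM mulmxV.
Qed.

Lemma row_free_const_independent q m (Z : 'M[{poly F}]_(q, m)) : row_free (map_mx tf Z) -> const_independent Z.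
Proof.
move=> free u uZ; apply/rowP => i; rewrite mxE.
have : map_mx tf (map_mx polyC u) *m map_mx tf Z = 0 by rewrite -map_mxM uZ map_mx0.
move/eqP; rewrite mulmx_free_eq0 // => /eqP/rowP/(_ i); rewrite !mxE => /eqP.
by rewrite tofrac_eq0 polyC_eq0 => /eqP.
Qed.

End LeadingRows.

Section GenericMatrix.
Variable F : fieldType.
Local Notation tf := (@tofrac {poly F}).

(** The second condition means that B has no null vector of degree less than b.
    The third one means that its null vectors of degree at most b are as few as
    possible, and prevents B from dropping rank at any point of the projective
    line. *)
Definition generic_matrix m a h b (B : 'M[{poly F}]_(m, a)) :=
  [/\ forall i j, (size (B i j) <= h.+1)%N, row_free (sylvester b (b + h) B)
    & row_full (sylvester b.+1 (b.+1 + h) B)].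

Lemma generic_on_line m a h b (B B' : 'M[{poly F}]_(m, a)) :
  (forall i j, (size (B i j) <= h.+1)%N) -> generic_matrix h b B' ->
  exists2 f : {poly F}, f != 0 & forall t, f.[t] != 0 -> generic_matrix h b (B + t%:P *: (B' - B)).
Proof.
move=> sB [sB' free full].
have E : B + 1%:P *: (B' - B) = B' by rewrite scale1r addrC subrK.
have [] := @row_free_line _ _ _ (sylvester b (b + h) B) (sylvester b (b + h) (B' - B)) 1.
  by rewrite -sylvesterD E.
move=> f f0 hf.
have [] := @row_full_line _ _ _ (sylvester b.+1 (b.+1 + h) B) (sylvester b.+1 (b.+1 + h) (B' - B)) 1.
  by rewrite -sylvesterD E.
move=> g g0 hg.
exists (f * g) => [|t]; first by rewrite mulf_neq0.
rewrite hornerM mulf_eq0 negb_or => /andP[/hf h1 /hg h2]; split; rewrite ?sylvesterD //.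
move=> i j; rewrite !mxE mul_polyC; apply: leq_trans (size_polyD _ _) _.
rewrite geq_max sB /=; apply: leq_trans (size_scale_leq _ _) _.
by apply: leq_trans (size_polyD _ _) _; rewrite size_polyN geq_max sB sB'.
Qed.

Lemma generic_left_inverse m a h b (B : 'M[{poly F}]_(m, a)) : generic_matrix h b B ->
  exists G : 'M[{poly F}]_(a, m), G *m B = 1%:M.
Proof. by case=> sB _ full; apply: (@left_inverse_of_full _ _ _ h B sB b.+1). Qed.

Lemma rank_sylvester_full m a h k (B : 'M[{poly F}]_(m, a)) : row_full (sylvester k (k + h) B) ->
  \rank (sylvester k (k + h) B) = (a * (k + h))%N.
Proof. by move/eqP. Qed.

Lemma generic_null_bound m a h b (B : 'M[{poly F}]_(m, a)) q (Z : 'M[{poly F}]_(q, m)) :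
  generic_matrix h b B -> (forall i j, (size (Z i j) <= b.+1)%N) -> Z *m B = 0 ->
  row_free (map_mx tf Z) -> (q <= m * b.+1 - a * (b.+1 + h))%N.
Proof.
case=> sB _ full sZ ZB /row_free_const_independent Zi.
by rewrite -(rank_sylvester_full full); apply: const_independent_bound.
Qed.

(** X is a basis over the constants of the null vectors of degree at most b.
    Independence over the rational functions comes from top coefficients in
    degree b + 1. Those of 'X X are independent, as no null vector has degree
    less than b. Those of all null vectors of degree b + 1 span a space of
    dimension at least m - a, as the null vectors without such a coefficient form
    a space of dimension p only. Hence Y can be chosen so that its top
    coefficients complete those of 'X X. *)
Lemma generic_null_basis m a h b (B : 'M[{poly F}]_(m, a)) 
  (p := (m * b.+1 - a * (b.+1 + h))%N) : (a <= m)%N -> (a * (b.+1 + h) <= m * b.+1)%N ->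
  generic_matrix h b B ->
  exists (X : 'M[{poly F}]_(p, m)) (Y : 'M[{poly F}]_(m - a - p, m)),
  [/\ forall i j, (size (X i j) <= b.+1)%N, forall i j, (size (Y i j) <= b.+2)%N,
      col_mx X Y *m B = 0 & row_free (map_mx tf (col_mx X Y))].
Proof.
move=> am hp [sB free full].
have full2 := sylvester_full_succ sB full (ltn0Sn b).
have := kernel_family sB b.+1; rewrite (rank_sylvester_full full) -/p => -[X [sX XB Xi _]].
have := kernel_family sB b.+2; rewrite (rank_sylvester_full full2).
set p2 := (_ - _)%N => -[Y [sY YB Yi Yspan]].
have p2E : (p2 = p + (m - a))%N.
  have E1 : (m * b.+2 = m * b.+1 + m)%N by rewrite mulnSr.
  have E2 : (a * (b.+2 + h) = a * (b.+1 + h) + a)%N by rewrite [(b.+2 + h)%N]addSn mulnSr.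
  rewrite /p2 /p E1 E2; move: hp am.
  by move: (a * _)%N (m * _)%N => x y; lia.
pose T0 := coef_rows b X; pose T2 := coef_rows b.+1 Y.
have T0free : row_free T0.
  rewrite -kermx_eq0; apply/eqP/row_matrixP => i; rewrite row0; apply: Xi.
  apply: (sylvester_inj free); last by rewrite -mulmxA XB mulmx0.
  move=> j; apply/leq_sizeP => l; rewrite leq_eqVlt => /predU1P[<-|bl].
    have := coef_rows_mul b (row i (kermx T0)) X; rewrite -row_mul mulmx_ker row0.
    by move/(congr1 (fun M : 'rV_m => M 0 j)); rewrite !mxE.
  by rewrite nth_default //; apply: leq_trans bl; apply: size_mul_const.
have rkT2 : (m - a <= \rank T2)%N.
  have : (\rank (kermx T2) <= p)%N.
    rewrite -[p]/(m * b.+1 - _)%N -(rank_sylvester_full full).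
    set U := row_base (kermx T2).
    have UT : U *m T2 = 0 by apply/sub_kermxP; rewrite eq_row_base.
    apply: (@const_independent_bound _ _ _ h B b.+1 _ (map_mx polyC U *m Y)).
    - move=> i j; apply/leq_sizeP => l; rewrite leq_eqVlt => /predU1P[<-|bl].
        have := coef_rows_mul b.+1 U Y; rewrite UT.
        by move/(congr1 (fun M : 'M[_]_(_, m) => M i j)); rewrite !mxE.
      by rewrite nth_default //; apply: leq_trans bl; apply: size_mul_const.
    - by rewrite -mulmxA YB mulmx0.
    move=> u; rewrite mulmxA -map_mxM => /Yi /eqP.
    by rewrite mulmx_free_eq0 ?row_base_free // => /eqP.
  rewrite mxrank_ker; have := rank_leq_row T2; move: (\rank T2) p2E => x.
  by clearbody p p2; lia.
have T0T2 : (T0 <= T2)%MS.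
  apply/row_subP => i.
  have [||u Eu] := Yspan ('X *: row i X).
  - move=> j; rewrite !mxE mulrC; apply: leq_trans (size_polyMleq _ _) _.
    by rewrite size_polyX; have := sX i j; move: (size _) => x; lia.
  - by rewrite -scalemxAl -row_mul XB row0 scaler0.
  apply/submxP; exists u; rewrite -coef_rows_mul -Eu.
  by apply/rowP => j; rewrite !mxE /coefp coefXM.
have rkT0 : \rank T0 = p by apply/eqP.
set W := row_base (T2 :\: T0)%MS.
have rW : (m - a - p <= \rank (T2 :\: T0)%MS)%N.
  have := mxrank_cap_compl T2 T0; have := mxrankS (capmxSr T2 T0).
  by rewrite rkT0; move: rkT2; lia.
pose W' := rowsub (widen_ord rW) W.
have W'free : row_free (col_mx T0 W').
  have W'f : row_free W'.
    have /row_freeP[R hR] := row_base_free (T2 :\: T0)%MS.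
    apply/row_freeP; exists (R *m (rowsub (widen_ord rW) 1%:M)^T).
    rewrite /W' rowsubE mulmxA -(mulmxA _ W) hR mulmx1; apply/matrixP => i j.
    rewrite mxE (bigD1 (widen_ord rW i)) //= !mxE eqxx mul1r big1 ?addr0 => [|k /negPf ki].
      by rewrite eq_sym.
    by rewrite !mxE eq_sym ki mul0r.
  rewrite -row_leq_rank -addsmxE mxrank_disjoint_sum; first by rewrite rkT0 (eqP W'f).
  apply/eqP; rewrite -submx0 -(capmx_diff T2 T0) capmxC capmxS //.
  by apply: submx_trans (rowsub_sub _ _) _; rewrite eq_row_base.
have : (W' <= T2)%MS.
  by apply: submx_trans (rowsub_sub _ _) _; rewrite eq_row_base diffmxSl.
case/submxP => V EV.
exists X, (map_mx polyC V *m Y); split=> //.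
- by move=> i j; apply: size_mul_const.
- by rewrite mul_col_mx XB -mulmxA YB mulmx0 col_mx0.
have : row_free (map_mx tf (col_mx ('X *: X) (map_mx polyC V *m Y))).
  apply: (@leading_rows_free _ b.+1).
    move=> i j; rewrite mxE; case: splitP => k _; last exact: size_mul_const.
    rewrite !mxE mulrC; apply: leq_trans (size_polyMleq _ _) _.
    by rewrite size_polyX; have := sX k j; move: (size _) => x; lia.
  congr (row_free _): W'free; rewrite /coef_rows map_col_mx; congr col_mx.
    by apply/matrixP => i j; rewrite !mxE /coefp coefXM.
  by rewrite EV -coef_rows_mul.
rewrite -!row_leq_rank => h1; apply: leq_trans h1 _.
have -> : col_mx ('X *: X) (map_mx polyC V *m Y) = block_mx 'X%:M 0 0 1%:M *m col_mx X (map_mx polyC V *m Y).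
  by rewrite mul_block_col !mul0mx add0r addr0 mul1mx mul_scalar_mx.
by rewrite map_mxM mxrankM_maxr.
Qed.

End GenericMatrix.

(** The two conditions hold for two different zigzag matrices, hence
    simultaneously at almost all points of the line through them. *)
Lemma generic_matrix_exists (F : numFieldType) m a h b :
  (m * b <= a * (b + h))%N -> (a * (b.+1 + h) <= m * b.+1)%N ->
  exists B : 'M[{poly F}]_(m, a), generic_matrix h b B.
Proof.
move=> hf hF; pose B1 : 'M[{poly F}]_(m, a) := zigzag F a m b.+1 h.
have full1 : row_full (sylvester b.+1 (b.+1 + h) B1) by exact: zigzag_row_full.
have sB1 := @size_zigzag F a m b.+1 h.
have [B2 sB2 free2] : exists2 B2 : 'M[{poly F}]_(m, a), (forall i j, (size (B2 i j) <= h.+1)%N) &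
    row_free (sylvester b (b + h) B2).
  case: b hf {hF B1 full1 sB1} => [|b] hf; last first.
    by exists (zigzag F a m b.+1 h); [exact: size_zigzag|exact: zigzag_row_free].
  exists 0; first by move=> i j; rewrite mxE size_poly0.
  by rewrite -row_leq_rank; apply: leq_trans (leq0n _); rewrite muln0.
have [] := @row_free_line _ _ _ (sylvester b (b + h) B1) (sylvester b (b + h) (B2 - B1)) 1.
  by rewrite -sylvesterD scale1r addrC subrK.
move=> f f0 hfr.
have [] := @row_full_line _ _ _ (sylvester b.+1 (b.+1 + h) B1) (sylvester b.+1 (b.+1 + h) (B2 - B1)) 0.
  by rewrite scale0r addr0.
move=> g g0 hg.
have [n] := poly_nonroot (mulf_neq0 f0 g0); rewrite hornerM mulf_eq0 negb_or.
case/andP=> /hfr h1 /hg h2; exists (B1 + n%:R%:P *: (B2 - B1)); split; rewrite ?sylvesterD //.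
move=> i j; rewrite !mxE mul_polyC; apply: leq_trans (size_polyD _ _) _.
rewrite geq_max; apply/andP; split; first by have := sB1 i j; rewrite mxE.
apply: leq_trans (size_scale_leq _ _) _.
have := sB1 i j; rewrite mxE => s1.
by apply: leq_trans (size_polyD _ _) _; rewrite size_polyN geq_max sB2 s1.
Qed.
(** * Unimodular completion *)
Section UnimodularCompletion.
Variable F : fieldType.
Local Notation T := {poly F}.

Lemma bezout_cofactors (p q : T) : (p != 0) || (q != 0) ->
  exists u w p' q', [/\ u * p' + w * q' = 1 & p * q' = q * p'].
Proof.
move=> pq0; have [[u w] /= Euw] := Bezoutp p q.
set g := u * p + w * q in Euw.
have g0 : g != 0.
  apply: contraTneq pq0 => g0; move: Euw; rewrite g0 eqp_sym eqp0 gcdp_eq0.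
  by rewrite -negb_and negbK.
have gp : p %/ g * g = p by rewrite divpK // (eqp_dvdl _ Euw) dvdp_gcdl.
have gq : q %/ g * g = q by rewrite divpK // (eqp_dvdl _ Euw) dvdp_gcdr.
exists u, w, (p %/ g), (q %/ g); split.
  by apply: (mulIf g0); rewrite mulrDl -!mulrA gp gq mul1r.
by rewrite -[in LHS]gp -[in RHS]gq; ring.
Qed.

Let scalar_mxD n (x y : T) : (x + y)%:M = x%:M + y%:M :> 'M[_]_n.
Proof. exact: raddfD. Qed.

Lemma unimodular_row m (v : 'rV[T]_(1 + m)) :
  exists2 U : 'M[T]_(1 + m), U \in unitmx & exists g : 'M[T]_1, v *m U = row_mx g 0.
Proof.
elim: m v => [|m IH]; last rewrite -[m.+1]/(1 + m)%N; move=> v.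
  exists 1%:M; first exact: unitmx1.
  by exists (lsubmx v); rewrite mulmx1 -[LHS]hsubmxK; congr row_mx; rewrite [rsubmx _]thinmx0.
have [U1 U1u [q' Eq]] := IH (rsubmx v).
pose W1 : 'M[T]_(1 + (1 + m)) := block_mx 1%:M 0 0 U1.
have W1u : W1 \in unitmx by rewrite unitmxE det_ublock det1 mul1r -unitmxE.
have Ev : v *m W1 = row_mx (lsubmx v) (row_mx q' 0).
  by rewrite -[v]hsubmxK mul_row_block !mulmx0 mulmx1 addr0 add0r Eq row_mxKl.
move: Ev; rewrite [lsubmx v]mx11_scalar [q']mx11_scalar; set p := lsubmx v 0 0; set q := q' 0 0 => Ev.
have [pq0|] := boolP ((p != 0) || (q != 0)); last first.
  rewrite negb_or !negbK => /andP[_ /eqP q0]; exists W1 => //.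
  by exists p%:M; rewrite Ev q0 raddf0 row_mx0.
have [u [w [p1 [q1 [E1 E2]]]]] := bezout_cofactors pq0.
pose W : 'M[T]_(1 + (1 + m)) := block_mx u%:M (row_mx (- q1)%:M 0)
  (col_mx w%:M 0) (block_mx p1%:M 0 0 1%:M).
pose W' : 'M[T]_(1 + (1 + m)) := block_mx p1%:M (row_mx q1%:M 0)
  (col_mx (- w)%:M 0) (block_mx u%:M 0 0 1%:M).
have Wu : W \in unitmx.
  have [] // := @mulmx1_unit _ _ W W'.
  rewrite mulmx_block mul_row_col mul_mx_row mul_row_block mul_col_mx mul_block_col.
  rewrite mul_col_row mulmx_block !mulmx0 !mul0mx !mulmx1 !addr0 !add0r.
  rewrite add_row_mx add_col_mx add_block_mx !addr0 !add0r -!scalar_mxM -!scalar_mxD.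
  rewrite !mulrN !mulNr opprK [q1 * w]mulrC [p1 * w]mulrC [q1 * u]mulrC [p1 * u]mulrC.
  rewrite [w * q1 + _]addrC E1 !subrr raddf0 row_mx0 col_mx0.
  by rewrite [in RHS](scalar_mx_block 1 (1 + m)) (scalar_mx_block 1 m).
exists (W1 *m W); first by rewrite unitmx_mul W1u.
exists (p * u + q * w)%:M; rewrite mulmxA Ev mul_row_block mul_row_col mul_mx_row mul_row_block.
rewrite !mulmx0 !mul0mx !addr0 add_row_mx add0r -!scalar_mxM -!scalar_mxD.
by rewrite mulrN E2 addNr raddf0 row_mx0.
Qed.

(** Elimination by columns, row after row: the entry left by unimodular_row is
    invertible because N has a right inverse. *)
Lemma unimodular_completion a m (N : 'M[T]_(a, m)) (G : 'M[T]_(m, a)) : N *m G = 1%:M ->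
  (a <= m)%N /\ exists2 U : 'M[T]_m, U \in unitmx & N *m U = pid_mx a.
Proof.
elim: a m N G => [|a IH] m N G NG.
  by split=> //; exists 1%:M; rewrite ?unitmx1 // [LHS]flatmx0 [RHS]flatmx0.
case: m N G NG => [|m].
  move=> N G NG; exfalso; move: NG; rewrite [N]thinmx0 mul0mx => /matrixP/(_ 0 0).
  by rewrite !mxE => /eqP; rewrite eq_sym oner_eq0.
rewrite -[a.+1]/(1 + a)%N -[m.+1]/(1 + m)%N => N G NG.
have [U1 U1u [g Eg]] := @unimodular_row m (usubmx (N : 'M[_]_(1 + a, 1 + m))).
pose N1 : 'M[T]_(1 + a, 1 + m) := N *m U1.
pose G1 : 'M[T]_(1 + m, 1 + a) := invmx U1 *m G.
have NG1 : N1 *m G1 = 1%:M by rewrite /N1 /G1 mulmxA mulmxK.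
have EN1 : N1 = block_mx g 0 (dlsubmx N1) (drsubmx N1).
  rewrite -[LHS]submxK; congr block_mx.
    by rewrite /ulsubmx /N1 -mul_usub_mx Eg row_mxKl.
  by rewrite /ursubmx /N1 -mul_usub_mx Eg row_mxKr.
move: NG1; rewrite EN1 -[G1]submxK mulmx_block !mul0mx !addr0 -[X in _ = X]submxK.
rewrite scalar_mx_block block_mxKul block_mxKur block_mxKdl block_mxKdr.
case/eq_block_mx => Eul Eur _ Edr.
set al := ulsubmx G1 in Eul; set c := dlsubmx N1; set N2 := drsubmx N1 in Edr.
have alg : al *m g = 1%:M by apply: mulmx1C.
have be0 : ursubmx G1 = 0 by rewrite -[LHS]mul1mx -alg -mulmxA Eur mulmx0.
rewrite be0 mulmx0 add0r in Edr.
have [am [U2 U2u E2]] := IH _ _ _ Edr.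
split=> //.
pose D : 'M[T]_(1 + m) := block_mx al 0 0 U2.
pose L : 'M[T]_(1 + m) := block_mx 1%:M 0 (- (pid_mx a *m (c *m al))) 1%:M.
have Du : D \in unitmx.
  rewrite unitmxE det_ublock unitrM -!unitmxE U2u andbT.
  by have [] := mulmx1_unit alg.
have Lu : L \in unitmx by rewrite unitmxE det_lblock !det1 mulr1 unitr1.
exists (U1 *m D *m L); first by rewrite !unitmx_mul U1u Du.
rewrite !mulmxA -[N *m U1]/N1 EN1 mulmx_block !mulmx0 !mul0mx Eul -/c -/N2 E2 !addr0 !add0r.
rewrite mulmx_block !mul0mx !mulmx1 !mulmx0 !addr0 !add0r.
rewrite mulmxN [pid_mx a *m (pid_mx a *m _)]mulmxA pid_mx_id // pid_mx_1 mul1mx subrr.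
apply/matrixP => i j; rewrite [RHS]mxE.
rewrite mxE; case: (splitP i) => i' Ei; rewrite mxE; case: (splitP j) => j' Ej.
- by rewrite Ei Ej !ord1 mxE eqxx.
- by rewrite Ei Ej !ord1 mxE.
- by rewrite Ei Ej !ord1 mxE.
by rewrite Ei Ej mxE eqn_add2l ltn_add2l.
Qed.
End UnimodularCompletion.

(** * Elementary divisors of wedges *)
Section SmithForm.
Variable R : realType.
Local Notation C := R[i].

Lemma half_lt r (i : 'I_(r + r)) : (odd i * r + i./2 < r + r)%N.
Proof. by have := ltn_ord i; case: (odd i) => /=; lia. Qed.

(** The order of the columns that turns the block matrix of a symplectic form
    into a sequence of adjacent hyperbolic planes. *)
Definition unshuffle r (i : 'I_(r + r)) : 'I_(r + r) := Ordinal (half_lt i).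

Lemma unshuffle_inj r : injective (@unshuffle r).
Proof.
move=> i j /(congr1 val) /= E; apply: val_inj => /=.
have := ltn_ord i; have := ltn_ord j.
move: E; have := odd_double_half i; have := odd_double_half j.
by case: (odd i); case: (odd j) => /=; lia.
Qed.

Definition sympl (T : pzRingType) r : 'M[T]_(r + r) := block_mx 0 1%:M (- 1%:M) 0.

Lemma symplE (T : pzRingType) r i j : sympl T r i j = (j == (i + r)%N :> nat)%:R - (i == (j + r)%N :> nat)%:R.
Proof.
rewrite /sympl mxE; case: (splitP i) => i' Ei; rewrite mxE; case: (splitP j) => j' Ej; rewrite Ei Ej;
  have := ltn_ord i'; have := ltn_ord j'; rewrite !mxE => h1 h2.
- have -> : (j' == (i' + r)%N :> nat) = false by apply/eqP; lia.
  have -> : (i' == (j' + r)%N :> nat) = false by apply/eqP; lia.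
  by rewrite subrr.
- have -> : ((r + j')%N == (i' + r)%N) = (i' == j') by rewrite addnC eqn_add2r eq_sym.
  have -> : (i' == (r + j' + r)%N :> nat) = false by apply/eqP; lia.
  by rewrite subr0.
- have -> : ((r + i')%N == (j' + r)%N) = (i' == j') by rewrite addnC eqn_add2r.
  have -> : (j' == (r + i' + r)%N :> nat) = false by apply/eqP; lia.
  by rewrite sub0r.
- have -> : ((r + j')%N == (r + i' + r)%N) = false by apply/eqP; lia.
  have -> : ((r + i')%N == (r + j' + r)%N) = false by apply/eqP; lia.
  by rewrite subrr.
Qed.

Lemma wedge_sympl (T : pzRingType) m r (X Y : 'M[T]_(m, r)) :
  wedge X Y = row_mx X Y *m sympl T r *m (row_mx X Y)^T.
Proof.
rewrite /sympl mul_row_block !mulmx0 mulmx1 mulmxN mulmx1 add0r addr0.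
by rewrite tr_row_mx mul_row_col mulNmx addrC.
Qed.

Lemma sympl_unshuffle (T : pzRingType) r i j : sympl T r (unshuffle i) (unshuffle j) =
  if ~~ odd i && (j == i.+1 :> nat) then 1 : T
  else if ~~ odd j && (i == j.+1 :> nat) then -1 else 0.
Proof.
rewrite symplE /=; have hi := odd_double_half i; have hj := odd_double_half j.
have li := ltn_ord i; have lj := ltn_ord j.
have E1 : (odd j * r + j./2 == odd i * r + i./2 + r)%N = ~~ odd i && (j == i.+1 :> nat).
  by move: hi hj li lj; case: (odd i); case: (odd j) => /= hi hj li lj;
    [apply/negbTE/eqP|apply/negbTE/eqP|apply/eqP/eqP|apply/eqP/eqP]; lia.
have E2 : (odd i * r + i./2 == odd j * r + j./2 + r)%N = ~~ odd j && (i == j.+1 :> nat).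
  by move: hi hj li lj; case: (odd i); case: (odd j) => /= hi hj li lj;
    [apply/negbTE/eqP|apply/eqP/eqP|apply/negbTE/eqP|apply/eqP/eqP]; lia.
rewrite E1 E2; case: ifP => [/andP[oi /eqP h]|_].
  have -> : (i == j.+1 :> nat) = false by apply/eqP; lia.
  by rewrite andbF subr0.
by case: ifP => _ /=; rewrite ?mulr1n ?mulr0n sub0r ?oppr0.
Qed.

Lemma wedge_smith m r (X Y : 'M[{poly C}]_(m, r)) (G : 'M[{poly C}]_(r + r, m)) :
  G *m row_mx X Y = 1%:M -> skew_smith (wedge X Y) (nseq r 1).
Proof.
move=> GB.
(* A unimodular U reduces the transpose of [X Y] Phi to [I 0], where Phi permutes
   the columns; congruence by U then turns wedge X Y into the permuted symplectic
   matrix bordered by zeros. *)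
pose Phi : 'M[{poly C}]_(r + r) := colsub (@unshuffle r) 1%:M.
have PhiM : Phi^T *m Phi = 1%:M.
  apply/matrixP => i j; rewrite mxE (bigD1 (unshuffle i)) //= !mxE eqxx mul1r big1 ?addr0.
    by rewrite (inj_eq (@unshuffle_inj r)).
  by move=> k /negPf hk; rewrite !mxE hk mul0r.
have PhiM' : Phi *m Phi^T = 1%:M by apply: mulmx1C.
have MPhi k (M : 'M[{poly C}]_(k, r + r)) : M *m Phi = colsub (@unshuffle r) M.
  by rewrite /Phi mulmx_colsub mulmx1.
pose B := row_mx X Y *m Phi.
have BG : B^T *m (G^T *m Phi) = 1%:M.
  by rewrite /B trmx_mul -mulmxA (mulmxA _ G^T) -trmx_mul GB trmx1 mul1mx.
have [rm [U Uu EU]] := unimodular_completion BG.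
have PB : wedge X Y = B *m (Phi^T *m sympl {poly C} r *m Phi) *m B^T.
  rewrite wedge_sympl /B trmx_mul !mulmxA -(mulmxA _ Phi Phi^T) PhiM' mulmx1.
  by rewrite -(mulmxA _ Phi Phi^T) PhiM' mulmx1.
pose J := Phi^T *m sympl {poly C} r *m Phi.
have JE i j : J i j = sympl {poly C} r (unshuffle i) (unshuffle j).
  by rewrite /J MPhi mxE -[Phi^T *m _]trmxK trmx_mul trmxK mxE MPhi !mxE.
split; rewrite ?size_nseq //.
- by rewrite mul2n -addnn.
- by rewrite all_nseq monic1 orbT.
- by case: (r) => //= n; elim: n => //= n ->; rewrite dvd1p.
exists U.
  move: Uu; rewrite unitmxE poly_unitE => /andP[/eqP sz h].
  by exists (\det U)`_0; [rewrite -unitfE|apply: size1_polyC; rewrite sz].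
have -> : U^T *m wedge X Y *m U = (B^T *m U)^T *m J *m (B^T *m U).
  by rewrite PB (trmx_mul B^T U) trmxK /J !mulmxA.
rewrite EU.
have Mp k (M : 'M[{poly C}]_(k, r + r)) a (b : 'I_m) : (M *m (pid_mx (r + r) : 'M[_]_(r + r, m))) a b =
    if insub (b : nat) is Some b' then M a b' else 0.
  rewrite mxE; case: insubP => [b' hb Eb|hb].
    rewrite (bigD1 b') //= mxE Eb eqxx hb mulr1 big1 ?addr0 // => x xb.
    by rewrite mxE -Eb (inj_eq val_inj) (negPf xb) mulr0.
  by rewrite big1 // => x _; rewrite mxE; case: eqP => [E|]; rewrite ?mulr0 // E (negPf hb) mulr0.
apply/matrixP => i j; rewrite Mp [RHS]mxE.
have Mq b' : ((pid_mx (r + r) : 'M[_]_(r + r, m))^T *m J) i b' = if insub (i : nat) is Some i' then J i' b' else 0.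
  rewrite -[_^T *m J]trmxK trmx_mul trmxK mxE Mp; case: insubP => // u _ _; by rewrite mxE.
have nth1 k : (nseq r (1 : {poly C}))`_k = (k < r)%N%:R by rewrite nth_nseq; case: ltnP.
rewrite !nth1; case: insubP => [j' hj Ej|hj]; rewrite ?Mq; last first.
  case: ifP => [/andP[oi /eqP h]|_].
    have -> : (i./2 < r)%N = false; last by [].
    apply/negP => h3; move: hj oi (odd_double_half i); rewrite h.
    by case: (odd i) => //= h1 _ h2; lia.
  case: ifP => // /andP[oj /eqP h].
  have -> : (j./2 < r)%N = false; last by rewrite oppr0.
  apply/negP => h3; move: hj oj (odd_double_half j).
  by case: (odd j) => //= h1 _ h2; lia.
case: insubP => [i' hi Ei|hi].
  rewrite JE sympl_unshuffle Ei Ej; case: ifP => [/andP[oi /eqP h]|_].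
    have -> : (i./2 < r)%N = true by have := odd_double_half i; lia.
    by [].
  case: ifP => // /andP[oj /eqP h].
  have -> : (j./2 < r)%N = true by have := odd_double_half j; lia.
  by [].
case: ifP => [/andP[oi /eqP h]|_]; first by exfalso; move: hi hj; rewrite h; lia.
case: ifP => // /andP[oj /eqP h].
exfalso; move: hi hj oj (odd_double_half j); rewrite h.
by case: (odd j) => //= h1 h2 _ h3; lia.
Qed.

End SmithForm.

Section WedgeRank.
Lemma rank_wedge (K : fieldType) m r (X Y : 'M[K]_(m, r)) (G : 'M[_]_(r + r, m)) :
  G *m row_mx X Y = 1%:M -> \rank (wedge X Y) = (r + r)%N.
Proof.
move=> GB; rewrite wedge_sympl; set B := row_mx X Y in GB *.
apply/eqP; rewrite eqn_leq; apply/andP; split.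
  by apply: leq_trans (mxrankM_maxl _ _) _; apply: leq_trans (mxrankM_maxr _ _) _; exact: rank_leq_row.
have E : G *m (B *m sympl K r *m B^T) *m G^T = sympl K r.
  by rewrite !mulmxA GB mul1mx -mulmxA -trmx_mul GB trmx1 mulmx1.
have : sympl K r \in unitmx.
  have [] // := @mulmx1_unit _ _ (sympl K r) (- sympl K r).
  rewrite mulmxN /sympl mulmx_block !mulmx0 !mul0mx !mulmxN !mulmx1 !addr0 !add0r.
  by rewrite opp_block_mx !opprK oppr0 -scalar_mx_block.
rewrite -row_free_unit => /eqP {1}<-; rewrite -{1}E.
by apply: leq_trans (mxrankM_maxl _ _) _; apply: mxrankM_maxr.
Qed.

Lemma rank_map_wedge (T : comPzRingType) (K : fieldType) (f : {rmorphism T -> K}) m r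
    (X Y : 'M[T]_(m, r)) (G : 'M[_]_(r + r, m)) :
  G *m row_mx X Y = 1%:M -> \rank (map_mx f (wedge X Y)) = (r + r)%N.
Proof.
move=> GB; rewrite map_wedge; apply: (@rank_wedge _ _ _ _ _ (map_mx f G)).
by rewrite -map_row_mx -map_mxM GB map_scalar_mx rmorph1.
Qed.
End WedgeRank.

Section NoElementaryDivisors.
Variable R : realType.
Local Notation C := R[i].

Definition rank_constant m (P : 'M[{poly C}]_m) :=
  forall a b, \rank (map_mx (horner_eval a) P) = \rank (map_mx (horner_eval b) P).

(** Let b be a point where no invariant polynomial vanishes. Each row of the
    canonical form Z at a is a multiple of the same row at b. Since the ranks
    agree, the two row spaces coincide; but if p is the invariant polynomial of
    index k and vanishes at a, then column 2k + 1 is zero in Z a and not in Z b. *)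
Lemma smith_no_root m (P : 'M[{poly C}]_m) g a p : rank_constant P ->
  skew_smith P g -> p \in g -> ~~ root p a.
Proof.
move=> Pc [sg mg _ [F [c c0 detF] FP]] pg.
pose Z x := map_mx (horner_eval x) (skew_canonical m g).
have Zrank x y : \rank (Z x) = \rank (Z y).
  suff h x0 : \rank (Z x0) = \rank (map_mx (horner_eval x0) P) by rewrite !h.
  have Fu : map_mx (horner_eval x0) F \in unitmx.
    by rewrite unitmxE det_map_mx detF /= /horner_eval hornerC unitfE.
  rewrite /Z -FP !map_mxM mxrankMfree ?row_free_unit // -map_trmx.
  by rewrite -mxrank_tr trmx_mul trmxK mxrankMfree ?row_free_unit // mxrank_tr.
have prod0 : \prod_(q <- g) q != 0.
  rewrite prodf_seq_neq0; apply/allP => q qg; apply: monic_neq0.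
  by have /allP/(_ _ qg) := mg.
have [n hn] := poly_nonroot prod0; set b := n%:R in hn.
have gb q : q \in g -> q.[b] != 0.
  move=> qg; apply: contraNneq hn => h; rewrite horner_prod.
  by rewrite (big_rem _ qg) /= h mul0r.
apply/negP => /rootP pa.
have [k kg Ek] : exists2 k, (k < size g)%N & g`_k = p by exists (index p g); rewrite ?index_mem ?nth_index.
have ZE x i j : Z x i j = if ~~ odd i && (j == i.+1 :> nat) then (g`_(i./2)).[x]
    else if ~~ odd j && (i == j.+1 :> nat) then - (g`_(j./2)).[x] else 0.
  by rewrite !mxE /horner_eval; case: ifP => // _; case: ifP; rewrite ?hornerN ?horner0.
have Zsub : (Z a <= Z b)%MS.
  apply/row_subP => i.
  pose e := if odd i then (g`_(i.-1./2)) else (g`_(i./2)).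
  have -> : row i (Z a) = (e.[a] / e.[b]) *: row i (Z b).
    apply/rowP => j; rewrite !mxE /horner_eval.
    have main (q : {poly C}) : q = e -> q.[a] = e.[a] / e.[b] * q.[b].
      move=> ->; have [h|h] := boolP (e \in g); first by rewrite divfK // gb.
      have -> : e = 0; last by rewrite !horner0 mulr0.
      by move: h; rewrite /e; case: ifP => _ h; apply: nth_default; rewrite leqNgt; apply: contra h => h; exact: mem_nth.
    case: ifP => [/andP[oi _]|_]; first by apply: main; rewrite /e (negPf oi).
    case: ifP => [/andP[oj /eqP ij]|_]; last by rewrite !horner0 mulr0.
    by rewrite !hornerN mulrN; congr (- _); apply: main; rewrite /e ij /= oj.
  by apply: scalemx_sub; apply: row_sub.
have Zle : (Z b <= Z a)%MS.
  by rewrite -(mxrank_leqif_sup Zsub).2 (Zrank a b).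
have im : (k.*2 < m)%N by apply: leq_trans sg; rewrite mul2n ltn_double.
have jm : (k.*2.+1 < m)%N by apply: leq_trans sg; rewrite mul2n -doubleS leq_double.
have /submxP[u Eu] := submx_trans (row_sub (Ordinal im) (Z b)) Zle.
have := congr1 (fun v : 'rV_m => v 0 (Ordinal jm)) Eu.
rewrite mxE ZE /= odd_double eqxx /= doubleK mxE big1 => [h|i _].
  by have := gb p pg; rewrite -Ek h eqxx.
rewrite ZE /= odd_double /=; case: ifP => [/andP[oi /eqP[ki]]|_]; last by rewrite mulr0.
by rewrite -ki doubleK Ek pa mulr0.
Qed.

Lemma rank_constant_multiplicities m (P : 'M[{poly C}]_m) a s : rank_constant P ->
  partial_multiplicities P a s -> all (fun n => n == 0)%N s.
Proof.
move=> Pc [g Pg ->]; apply/allP => n /flattenP[t /mapP[p pg ->]].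
have -> : mup a p = 0%N by apply/mupNroot/(smith_no_root _ Pc Pg pg).
by rewrite !inE orbb.
Qed.

Lemma rank_constant_not_eigenvalue m (P : 'M[{poly C}]_m) a : rank_constant P -> ~ Defs.eigenvalue P a.
Proof.
move=> Pc [s /(rank_constant_multiplicities Pc) /allP h] /hasP[n /h /eqP->].
by [].
Qed.

Lemma rank_constant_elementary m (P : 'M[{poly C}]_m) a e : rank_constant P ->
  elementary_divisors P a e -> e = [::].
Proof.
move=> Pc [s /(rank_constant_multiplicities Pc) h ->].
elim: s h => //= n s IH /andP[/eqP-> h]; exact: IH.
Qed.

Variables (m r : nat) (X Y : 'M[{poly C}]_(m, r)) (G : 'M[{poly C}]_(r + r, m)).
Hypothesis GB : G *m row_mx X Y = 1%:M.

Lemma wedge_rank_constant : rank_constant (wedge X Y).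
Proof. by move=> a b; rewrite !(rank_map_wedge _ GB). Qed.

Lemma prank_wedge : prank (wedge X Y) = (r + r)%N.
Proof. exact: (rank_map_wedge _ GB). Qed.

Lemma wedge_elementary_divisors a e : elementary_divisors (wedge X Y) a e <-> e = [::].
Proof.
split=> [|->]; first by apply: rank_constant_elementary wedge_rank_constant.
exists (flatten [seq [:: mup a p; mup a p] | p <- nseq r (1 : {poly C})]).
  by exists (nseq r 1) => //; apply: wedge_smith GB.
have m0 : mup a (1 : {poly C}) = 0%N by apply: mupNroot; rewrite root1.
by elim: r => //= k; rewrite m0.
Qed.

Lemma wedge_not_eigenvalue a : ~ Defs.eigenvalue (wedge X Y) a.
Proof. exact: rank_constant_not_eigenvalue wedge_rank_constant. Qed.

End NoElementaryDivisors.

(** * Minimal indices *)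
Section DegreeSequences.

Lemma sumn_count_pos (E : seq nat) : (count (fun x => 0 < x) E <= sumn E)%N /\
  ((sumn E <= count (fun x => 0 < x) E)%N -> all (fun x => x <= 1)%N E).
Proof.
elim: E => //= x E [IH1 IH2]; split; first by case: x => [|x] /=; lia.
by case: x => [|[|x]] /= h; [rewrite IH2 //; lia|rewrite IH2 //; lia|exfalso; lia].
Qed.

Lemma sumn_shift b (D : seq nat) : all (leq b) D ->
  (sumn D = size D * b + sumn [seq x - b | x <- D])%N.
Proof. by elim: D => //= x D IH /andP[bx /IH->]; rewrite mulSn; lia. Qed.

Lemma degrees_lower_bound n b t (D : seq nat) : size D = n -> all (leq b) D ->
  (count (pred1 b) D <= n - t)%N -> (t <= n)%N -> (n * b + t <= sumn D)%N.
Proof.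
move=> sD bD cD tn; rewrite (sumn_shift bD) sD leq_add2l.
apply: leq_trans (sumn_count_pos _).1; rewrite count_map.
have := count_predC (pred1 b) D; rewrite sD.
have -> : count (preim (fun x => x - b)%N (fun x => 0 < x)%N) D = count (predC (pred1 b)) D.
  by apply: eq_in_count => x /(allP bD) /= bx; rewrite subn_gt0 ltn_neqAle bx andbT eq_sym.
by move=> cC; lia.
Qed.

(** The case of equality in degrees_lower_bound. *)
Lemma degrees_perm n b t (D : seq nat) : size D = n -> all (leq b) D ->
  (count (pred1 b) D <= n - t)%N -> (t <= n)%N -> (sumn D <= n * b + t)%N ->
  perm_eq D (nseq (n - t) b ++ nseq t b.+1).
Proof.
move=> sD bD cD tn sumD.
have cpos : count (preim (fun x => x - b)%N (fun x => 0 < x)%N) D = count (predC (pred1 b)) D.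
  by apply: eq_in_count => x /(allP bD) /= bx; rewrite subn_gt0 ltn_neqAle bx andbT eq_sym.
have cC := count_predC (pred1 b) D; rewrite sD in cC.
have [h1 h2] := sumn_count_pos [seq x - b | x <- D]%N; rewrite !count_map cpos in h1 h2.
have h3 := sumn_shift bD; rewrite sD in h3.
have {h2} le1 : all (fun x => x <= 1)%N [seq x - b | x <- D]%N by apply: h2; lia.
have two x : x \in D -> (x == b) || (x == b.+1).
  move=> xD; have bx := allP bD _ xD; have := allP le1 (x - b)%N (map_f _ xD); move: bx => /=; lia.
have c1 : count (pred1 b) D = (n - t)%N by lia.
have c2 : count (pred1 b.+1) D = t.
  suff -> : count (pred1 b.+1) D = count (predC (pred1 b)) D by lia.
  apply: eq_in_count => x /two /= /orP[/eqP->|/eqP->]; rewrite eqxx ?(gtn_eqF (ltnSn b)) //.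
  by rewrite (ltn_eqF (ltnSn b)).
apply/allP => x; rewrite mem_cat => /orP[xD|].
  have /orP[/eqP->|/eqP->] := two x xD; rewrite /= count_cat !count_nseq /= eqxx ?c1 ?c2.
    by rewrite (gtn_eqF (ltnSn b)) mul0n addn0 mul1n eqxx.
  by rewrite (ltn_eqF (ltnSn b)) mul0n add0n mul1n eqxx.
rewrite mem_cat !mem_nseq => /orP[/andP[_ /eqP->]|/andP[_ /eqP->]]; rewrite /= count_cat !count_nseq /= eqxx ?c1 ?c2.
  by rewrite (gtn_eqF (ltnSn b)) mul0n addn0 mul1n eqxx.
by rewrite (ltn_eqF (ltnSn b)) mul0n add0n mul1n eqxx.
Qed.

Lemma sorted_indices n b t : sort leq (nseq (n - t) b ++ nseq t b.+1) = nseq (n - t) b ++ nseq t b.+1.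
Proof.
apply: sorted_sort; first exact: leq_trans.
elim: (n - t)%N => [|k IH] /=; first by case: t => //= t; elim: t => //= t ->; rewrite leqnn.
by move: IH; case: k => [|k] /=; [case: t => //= t ->; rewrite leqnSn|rewrite leqnn].
Qed.

End DegreeSequences.

Section MinimalIndices.
Variable R : realType.
Local Notation C := R[i].
Local Notation K := {fraction {poly C}}.

Lemma vdegree_le p q (v : 'M[{poly C}]_(p, q)) e :
  (vdegree v <= e)%N <-> forall i j, (size (v i j) <= e.+1)%N.
Proof.
split=> [/bigmax_leqP h i j|h].
  by have /bigmax_leqP/(_ j isT) := h i isT; case: (size _).
by apply/bigmax_leqP => i _; apply/bigmax_leqP => j _; have := h i j; case: (size _).
Qed.

Section Characterization.
Variables (p q : nat) (V : {vspace 'M[K]_(p, q)}) (n b t : nat).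
Hypothesis tn : (t <= n)%N.
Hypothesis dimV : \dim V = n.
Hypothesis no_small : forall v : 'M[{poly C}]_(p, q), fracmx v \in V ->
  (forall i j, (size (v i j) <= b)%N) -> v = 0.
Hypothesis few : forall X : seq 'M[{poly C}]_(p, q), free [seq fracmx v | v <- X] ->
  (forall v, v \in X -> fracmx v \in V) -> (forall v, v \in X -> vdegree v <= b)%N ->
  (size X <= n - t)%N.
Hypothesis enough : exists X : seq 'M[{poly C}]_(p, q), [/\ size X = n, free [seq fracmx v | v <- X],
  (forall v, v \in X -> fracmx v \in V) & (\sum_(v <- X) vdegree v <= n * b + t)%N].

Lemma basis_degrees (X : seq 'M[{poly C}]_(p, q)) : polynomial_basis V X ->
  [/\ size X = n, all (leq b) (map (@vdegree R p q) X) & (count (pred1 b) (map (@vdegree R p q) X) <= n - t)%N].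
Proof.
move=> bX; have fX := basis_free bX.
have XV v : v \in X -> fracmx v \in V by move=> vX; apply: (basis_mem bX); apply: map_f.
split.
- rewrite -dimV; case/andP: bX => /eqP <- /eqnP ->; by rewrite size_map.
- apply/allP => _ /mapP[v vX ->]; rewrite leqNgt; apply/negP => vb.
  have v0 : v = 0.
    apply: no_small; first exact: XV.
    by case: b vb => // b' h i j; have /vdegree_le := h.
  have := free_not0 fX (map_f _ vX); rewrite v0 /fracmx map_mx0 eqxx. by [].
rewrite count_map -size_filter; apply: few.
- set a := preim _ _; have Xa : perm_eq X (seq.filter a X ++ seq.filter (predC a) X).
    by rewrite perm_sym perm_filterC.
  by move: fX; rewrite (perm_free (perm_map (@fracmx R p q) Xa)) map_cat => /catl_free.
- by move=> v; rewrite mem_filter => /andP[_ /XV].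
by move=> v; rewrite mem_filter => /andP[/= /eqP->].
Qed.

(** The degrees of a polynomial basis of V are at least b, and at most n - t of
    them equal b. So they add up to at least n b + t, and a basis that reaches
    this bound can only have the degrees b and b + 1. *)
Lemma minimal_indices_unique s : minimal_indices V s <-> s = nseq (n - t) b ++ nseq t b.+1.
Proof.
have sumE (X : seq 'M[{poly C}]_(p, q)) : (\sum_(v <- X) vdegree v)%N = sumn (map (@vdegree R p q) X).
  by rewrite sumnE big_map.
have [X0 [sX0 fX0 X0V sumX0]] := enough.
have bX0 : polynomial_basis V X0.
  rewrite /polynomial_basis basisEfree fX0 dimV size_map sX0 leqnn andbT.
  by apply/span_subvP => _ /mapP[v vX ->]; exact: X0V.
have conv X : polynomial_basis V X -> (\sum_(v <- X) vdegree v <= n * b + t)%N ->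
    sort leq (map (@vdegree R p q) X) = nseq (n - t) b ++ nseq t b.+1.
  move=> /basis_degrees[sX bX cX]; rewrite sumE => sumX.
  rewrite -[RHS]sorted_indices; apply/perm_sortP; [exact: leq_total|exact: leq_trans|exact: anti_leq|].
  by apply: degrees_perm; rewrite ?size_map.
split=> [[X [bX minX] ->]|->].
  by apply: conv => //; apply: leq_trans (minX _ bX0) sumX0.
exists X0; last by rewrite conv.
split=> // Y /basis_degrees[sY bY cY]; apply: leq_trans sumX0 _.
by rewrite sumE; apply: degrees_lower_bound; rewrite ?size_map.
Qed.
End Characterization.
End MinimalIndices.

Section Nullspaces.
Variable R : realType.
Local Notation C := R[i].
Local Notation K := {fraction {poly C}}.
Local Notation tf := (@tofrac {poly C}).

Lemma free_row_free m (X : seq 'rV[K]_m) : free X = row_free (\matrix_(i < size X) X`_i).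
Proof.
apply/idP/idP => [/(@freeP _ _ _ (in_tuple X)) fX|rX].
  rewrite -kermx_eq0; apply/eqP/row_matrixP => i; rewrite row0.
  set N := kermx _; apply/rowP => j; rewrite [RHS]mxE; apply: (fX (fun j => row i N 0 j)).
  have : row i (kermx (\matrix_(i < size X) X`_i)) *m (\matrix_(i < size X) X`_i) = 0.
    by rewrite -row_mul mulmx_ker row0.
  by rewrite mulmx_sum_row => E; rewrite -[RHS]E; apply: eq_bigr => k _; rewrite rowK.
apply/(@freeP _ _ _ (in_tuple X)) => k Ek i.
have : (\row_j k j) *m (\matrix_(i < size X) X`_i) = 0.
  by rewrite mulmx_sum_row -[RHS]Ek; apply: eq_bigr => j _; rewrite rowK mxE.
by move/eqP; rewrite mulmx_free_eq0 // => /eqP/rowP/(_ i); rewrite !mxE.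
Qed.

Lemma free_rows q m (M : 'M[K]_(q, m)) : free [seq row i M | i <- enum 'I_q] = row_free M.
Proof.
rewrite free_row_free; set X := [seq _ | _ <- _].
have sX : size X = q by rewrite size_map size_enum_ord.
have nX (i : 'I_q) : X`_i = row i M.
  by rewrite /X (nth_map i) ?size_enum_ord // nth_ord_enum.
have E : (\matrix_(i < size X) X`_i == M)%MS.
  apply/andP; split; apply/row_subP => i.
    by rewrite rowK -[nat_of_ord i]/(nat_of_ord (cast_ord sX i)) nX row_sub.
  have := row_sub (cast_ord (esym sX) i) (\matrix_(i < size X) X`_i).
  by rewrite rowK /= nX.
by rewrite /row_free (eqmxP E) sX.
Qed.

Lemma mem_left_nullspace m (A : 'M[{poly C}]_m) (v : 'rV[{poly C}]_m) :
  (fracmx v \in left_nullspace A) = (v *m A == 0).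
Proof.
rewrite memv_ker lfunE /= /fracmx -map_mxM.
apply/eqP/eqP => [E|->]; last by rewrite map_mx0.
apply/matrixP => i j; have := congr1 (fun M : 'rV_m => M i j) E; rewrite !mxE => /eqP.
by rewrite tofrac_eq0 => /eqP.
Qed.

Lemma mem_left_nullspaceK m (A : 'M[{poly C}]_m) (v : 'rV[K]_m) :
  (v \in left_nullspace A) = (v *m fracmx A == 0).
Proof. by rewrite memv_ker lfunE. Qed.

Lemma mem_right_nullspaceK m (A : 'M[{poly C}]_m) (v : 'cV[K]_m) :
  (v \in right_nullspace A) = (fracmx A *m v == 0).
Proof. by rewrite memv_ker lfunE. Qed.

(** Both inequalities compare families of vectors, as rows of a matrix, with
    the kernel matrix of A. *)
Lemma dim_left_nullspace m (A : 'M[{poly C}]_m) : \dim (left_nullspace A) = (m - prank A)%N.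
Proof.
apply/eqP; rewrite eqn_leq; apply/andP; split.
  have := basis_free (vbasisP (left_nullspace A)); rewrite free_row_free.
  set M := \matrix_(i < _) _ => fM.
  rewrite -(size_tuple (vbasis (left_nullspace A))) -(eqP fM) /prank -mxrank_ker.
  apply: mxrankS; apply/sub_kermxP/row_matrixP => i; rewrite row0 row_mul rowK.
  by apply/eqP; rewrite -mem_left_nullspaceK; apply: vbasis_mem; apply: mem_nth.
set M := row_base (kermx (fracmx A)).
have fM := row_base_free (kermx (fracmx A)); rewrite -/M -free_rows in fM.
have sV : (<<[seq row i M | i <- enum 'I_(\rank (kermx (fracmx A)))]>> <= left_nullspace A)%VS.
  apply/span_subvP => _ /mapP[i _ ->]; rewrite mem_left_nullspaceK -row_mul.
  suff -> : M *m fracmx A = 0 by rewrite row0.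
  by apply/sub_kermxP; rewrite eq_row_base.
have := dimvS sV; move: fM; rewrite /free => /eqP ->; rewrite size_map size_enum_ord.
by rewrite mxrank_ker.
Qed.

Lemma vdegree_tr p q (v : 'M[{poly C}]_(p, q)) : vdegree v^T = vdegree v.
Proof. by apply/eqP; rewrite eqn_leq; apply/andP; split; apply/vdegree_le => i j; rewrite ?mxE; have /vdegree_le h := leqnn (vdegree v); have /vdegree_le h' := leqnn (vdegree v^T); [exact: h|have := h' j i; rewrite mxE]. Qed.

Lemma basis_of_tr p q (V : {vspace 'M[K]_(p, q)}) (V' : {vspace 'M[K]_(q, p)}) (X : seq 'M[K]_(p, q)) :
  (forall v, (v \in V) = (v^T \in V')) -> basis_of V X -> basis_of V' (map trmx X).
Proof.
move=> VV' bX; pose f : 'Hom('M[K]_(p, q), 'M[K]_(q, p)) := linfun trmx.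
have -> : V' = (f @: V)%VS.
  apply/vspaceP => v; apply/idP/memv_imgP => [vV|[u uV ->]]; last by rewrite lfunE /= -VV'.
  by exists v^T; rewrite ?lfunE ?VV' /= trmxK.
have -> : map trmx X = map f X by apply: eq_map => v; rewrite lfunE.
apply: limg_basis_of => //; apply/eqP; rewrite -subv0; apply/subvP => v.
rewrite memv_cap memv_ker lfunE /= => /andP[_ /eqP v0].
by rewrite -[v]trmxK v0 linear0 mem0v.
Qed.

Lemma minimal_indices_tr p q (V : {vspace 'M[K]_(p, q)}) (V' : {vspace 'M[K]_(q, p)}) s :
  (forall v, (v \in V) = (v^T \in V')) -> minimal_indices V s -> minimal_indices V' s.
Proof.
move=> VV' [X [bX minX] ->].
have V'V v : (v \in V') = (v^T \in V) by rewrite VV' trmxK.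
have frT a b (Z : seq 'M[{poly C}]_(a, b)) : [seq fracmx v | v <- map trmx Z] = map trmx [seq fracmx v | v <- Z].
  by rewrite -!map_comp; apply: eq_map => v; rewrite /= /fracmx map_trmx.
have dgT a b (Z : seq 'M[{poly C}]_(a, b)) : [seq vdegree v | v <- map trmx Z] = [seq vdegree v | v <- Z].
  by rewrite -map_comp; apply: eq_map => v; rewrite /= vdegree_tr.
exists (map trmx X); last by rewrite dgT.
split; first by rewrite /polynomial_basis frT; apply: basis_of_tr bX.
have sT a b (Z : seq 'M[{poly C}]_(a, b)) : (\sum_(v <- map trmx Z) vdegree v = \sum_(v <- Z) vdegree v)%N.
  by rewrite big_map; apply: eq_bigr => v _; rewrite vdegree_tr.
move=> Y bY; have := minX (map trmx Y); rewrite !sT; apply.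
by rewrite /polynomial_basis frT; apply: basis_of_tr bY.
Qed.

Section WedgeMinimalIndices.
Variables (m r h b t : nat) (X Y : 'M[{poly C}]_(m, r)).
Let a := (r + r)%N.
Let n := (m - a)%N.
Hypothesis am : (a <= m)%N.
Hypothesis tn : (t <= n)%N.
Hypothesis degrees_sum : (a * h = n * b + t)%N.
Hypothesis gB : generic_matrix h b (row_mx X Y).

(** In the factorization wedge_sympl, the factors other than the first one have
    right inverses. *)
Lemma wedge_null q (Z : 'M[{poly C}]_(q, m)) : Z *m wedge X Y = 0 <-> Z *m row_mx X Y = 0.
Proof.
have [G GB] := generic_left_inverse gB; rewrite wedge_sympl !mulmxA.
split=> [E|->]; last by rewrite !mul0mx.
have SS : sympl {poly C} r *m sympl {poly C} r = - 1%:M.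
  rewrite /sympl mulmx_block !mulmx0 !mul0mx !mulmxN !mulNmx !mulmx1 !addr0 !add0r.
  by rewrite [in RHS]scalar_mx_block opp_block_mx oppr0.
have : Z *m row_mx X Y *m sympl {poly C} r *m ((row_mx X Y)^T *m G^T) *m sympl {poly C} r = 0.
  by rewrite !mulmxA E !mul0mx.
rewrite -trmx_mul GB trmx1 mulmx1 -mulmxA SS mulmxN mulmx1 => /eqP.
by rewrite oppr_eq0 => /eqP.
Qed.

Let kerdim : (m * b.+1 - a * (b.+1 + h) = n - t)%N.
Proof.
rewrite mulnDr degrees_sum -[in LHS](subnK am) -/n mulnDl mulnS; lia.
Qed.

Let kerle : (a * (b.+1 + h) <= m * b.+1)%N.
Proof.
rewrite mulnDr degrees_sum -[in leqRHS](subnK am) -/n mulnDl [(n * b.+1)%N]mulnS; lia.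
Qed.

Lemma wedge_left_minimal_indices s :
  left_minimal_indices (wedge X Y) s <-> s = nseq (n - t) b ++ nseq t b.+1.
Proof.
have [G GB] := generic_left_inverse gB.
have mem v : fracmx v \in left_nullspace (wedge X Y) -> v *m row_mx X Y = 0.
  by rewrite mem_left_nullspace => /eqP /wedge_null.
apply: minimal_indices_unique => //.
- by rewrite dim_left_nullspace (prank_wedge GB).
- move=> v /mem vB sv; have [_ free _] := gB.
  by apply: (sylvester_inj free) vB => i; apply: sv.
- move=> Z fZ Zmem Zdeg; rewrite -kerdim.
  pose M : 'M[{poly C}]_(size Z, m) := \matrix_(i < size Z) Z`_i.
  apply: (@generic_null_bound _ _ _ h b _ _ M gB).
  + move=> i j; have /vdegree_le := Zdeg _ (mem_nth 0 (ltn_ord i)).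
    by move=> /(_ 0 j); rewrite mxE.
  + apply/row_matrixP => i; rewrite row_mul rowK row0; apply: mem.
    by apply: Zmem; apply: mem_nth.
  have sZ := size_map (@fracmx R 1 m) Z.
  suff rE : \rank (\matrix_(i < size [seq fracmx v | v <- Z]) [seq fracmx v | v <- Z]`_i) =
      \rank (map_mx tf M) by move: fZ; rewrite free_row_free /row_free rE sZ.
  have E (k k' : nat) (A : 'M[K]_(k, m)) (B : 'M[K]_(k', m)) : (A == B)%MS -> \rank A = \rank B.
    by move=> /eqmxP->.
  apply: E; apply/andP; split; apply/row_subP => i.
    have hi : (i < size Z)%N by rewrite -(size_map (@fracmx R 1 m)) ltn_ord.
    rewrite rowK (nth_map 0) //; have := row_sub (Ordinal hi) (map_mx tf M).
    by rewrite -map_row rowK.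
  have hi : (i < size [seq fracmx v | v <- Z])%N by rewrite size_map.
  have := row_sub (Ordinal hi) (\matrix_(i < size [seq fracmx v | v <- Z]) [seq fracmx v | v <- Z]`_i).
  by rewrite rowK (nth_map 0) //= -map_row rowK.
move: kerdim (generic_null_basis am kerle gB); move: (_ - _ * (_ + h))%N => p ->.
case=> X0 [Y0 [sX0 sY0 Z0 fZ]].
exists [seq row i (col_mx X0 Y0) | i <- enum 'I_(n - t + (n - (n - t)))]; split.
- by rewrite size_map size_enum_ord subnKC // leq_subr.
- rewrite -map_comp (eq_map (g := fun i => row i (map_mx tf (col_mx X0 Y0)))) ?free_rows //.
  by move=> i; rewrite /= /fracmx map_row.
- move=> _ /mapP[i _ ->]; rewrite mem_left_nullspace; apply/eqP/wedge_null.
  by rewrite -row_mul Z0 row0.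
rewrite big_map big_enum /= big_split_ord /=.
have h1 : (\sum_(i < n - t) vdegree (row (lshift (n - (n - t)) i) (col_mx X0 Y0)) <= (n - t) * b)%N.
  rewrite -[X in (_ <= X * _)%N]card_ord -sum_nat_const; apply: leq_sum => i _.
  by apply/vdegree_le => x y; rewrite mxE col_mxEu.
have h2 : (\sum_(i < n - (n - t)) vdegree (row (rshift (n - t) i) (col_mx X0 Y0)) <= (n - (n - t)) * b.+1)%N.
  rewrite -[X in (_ <= X * _)%N]card_ord -sum_nat_const; apply: leq_sum => i _.
  by apply/vdegree_le => x y; rewrite mxE col_mxEd.
apply: leq_trans (leq_add h1 h2) _; rewrite mulnS addnCA -mulnDl subnKC ?leq_subr //.
by rewrite addnC leq_add2l; lia.
Qed.

(** Transposition exchanges the two null spaces of a skew-symmetric matrix. *)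
Lemma wedge_right_minimal_indices s :
  right_minimal_indices (wedge X Y) s <-> s = nseq (n - t) b ++ nseq t b.+1.
Proof.
have VV' (v : 'rV[K]_m) : (v \in left_nullspace (wedge X Y)) = (v^T \in right_nullspace (wedge X Y)).
  rewrite mem_left_nullspaceK mem_right_nullspaceK -(inj_eq trmx_inj) trmx_mul trmx0.
  by rewrite /fracmx map_trmx tr_wedge map_mxN mulNmx oppr_eq0.
rewrite -wedge_left_minimal_indices; split; last exact: minimal_indices_tr.
by apply: minimal_indices_tr => v; rewrite VV' trmxK.
Qed.

End WedgeMinimalIndices.
End Nullspaces.

(** * Reversal of polynomial matrices *)
Section Reversal.
Variable F : numFieldType.

Implicit Types p q : {poly F}.

Definition revp (e : nat) (p : {poly F}) : {poly F} := \poly_(k < e.+1) p`_(e - k).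

Lemma horner_revp e p (x : F) : (size p <= e.+1)%N -> x != 0 -> (revp e p).[x] = x ^+ e * p.[x^-1].
Proof.
move=> sp x0; rewrite horner_poly (horner_coef_wide _ sp) mulr_sumr (reindex_inj rev_ord_inj) /=.
apply: eq_bigr => k _; rewrite subSS subKn; last by rewrite -ltnS.
rewrite mulrCA; congr (_ * _); by rewrite exprVn -expfB_cond // (negPf x0) add0n -ltnS.
Qed.

Lemma poly_eq_nonzero (p q : {poly F}) : (forall x, x != 0 -> p.[x] = q.[x]) -> p = q.
Proof.
move=> E; apply/eqP; rewrite -subr_eq0; apply/negPn/negP => d0.
have [n] := poly_nonroot (mulf_neq0 (negbT (polyX_eq0 F)) d0).
rewrite hornerM hornerX mulf_eq0 negb_or => /andP[/E h].
by rewrite hornerD hornerN h subrr eqxx.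
Qed.

(** At x != 0 both sides take the value x^(e+f) p(1/x) q(1/x). *)
Lemma revpM e f p q : (size p <= e.+1)%N -> (size q <= f.+1)%N ->
  revp (e + f) (p * q) = revp e p * revp f q.
Proof.
move=> sp sq; apply: poly_eq_nonzero => x x0.
rewrite hornerM !horner_revp ?hornerM ?exprD 1?mulrACA //.
by apply: leq_trans (size_polyMleq _ _) _; move: (size p) (size q) sp sq => a b; lia.
Qed.

Lemma revpD e p q : revp e (p + q) = revp e p + revp e q.
Proof. by apply/polyP => k; rewrite coefD !coef_poly; case: ifP; rewrite ?addr0 // coefD. Qed.

Lemma revpN e p : revp e (- p) = - revp e p.
Proof. by apply/polyP => k; rewrite coefN !coef_poly; case: ifP; rewrite ?oppr0 // coefN. Qed.

Lemma revp_sum e (I : Type) (s : seq I) (f : I -> {poly F}) :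
  revp e (\sum_(i <- s) f i) = \sum_(i <- s) revp e (f i).
Proof.
elim: s => [|i s IH]; last by rewrite !big_cons revpD IH.
by rewrite !big_nil; apply/polyP => k; rewrite coef_poly !coef0 if_same.
Qed.

Lemma revp_mulmx e f m n l (A : 'M[{poly F}]_(m, n)) (B : 'M[{poly F}]_(n, l)) :
  (forall i j, (size (A i j) <= e.+1)%N) -> (forall i j, (size (B i j) <= f.+1)%N) ->
  map_mx (revp (e + f)) (A *m B) = map_mx (revp e) A *m map_mx (revp f) B.
Proof.
move=> sA sB; apply/matrixP => i j; rewrite !mxE revp_sum; apply: eq_bigr => k _.
by rewrite revpM // !mxE.
Qed.

Lemma revp_wedge e m r (X Y : 'M[{poly F}]_(m, r)) :
  (forall i j, (size (X i j) <= e.+1)%N) -> (forall i j, (size (Y i j) <= e.+1)%N) ->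
  map_mx (revp (e + e)) (wedge X Y) = wedge (map_mx (revp e) X) (map_mx (revp e) Y).
Proof.
move=> sX sY; have st (Z : 'M[{poly F}]_(m, r)) : (forall i j, (size (Z i j) <= e.+1)%N) ->
    forall i j, (size (Z^T i j) <= e.+1)%N by move=> sZ i j; rewrite mxE.
rewrite /wedge !map_trmx -!revp_mulmx; try exact: st; try done.
by apply/matrixP => i j; rewrite !mxE revpD revpN.
Qed.

(** Solve v B = 'X^(b+h) e_i with v of degree at most b: the reversal of the right
    hand side is e_i. *)
Lemma generic_rev_left_inverse m a h b (B : 'M[{poly F}]_(m, a)) : generic_matrix h b B ->
  exists G : 'M[{poly F}]_(a, m), G *m map_mx (revp h) B = 1%:M.
Proof.
case=> sB _ full.
have ex i : exists v : 'rV[{poly F}]_m, v *m map_mx (revp h) B == delta_mx 0 i.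
  have [|v sv vB] := sylvester_surj sB full (w := 'X^(b + h) *: delta_mx 0 i).
    move=> j; rewrite !mxE; case: (_ && _); rewrite ?mulr0 ?size_poly0 // mulr1.
    by rewrite size_polyXn.
  exists (map_mx (revp b) v); apply/eqP.
  rewrite -revp_mulmx //; last by move=> x j; rewrite ord1; exact: sv.
  rewrite vB; apply/matrixP => x j; rewrite !mxE; case: (_ && _).
    apply/polyP => k; rewrite mulr1 coef_poly coefXn coef1.
    case: k => [|k]; first by rewrite subn0 eqxx.
    by case: ltnP => // kl; rewrite (ltn_eqF (_ : _ - _ < _)%N) //; lia.
  by rewrite mulr0; apply/polyP => k; rewrite coef_poly !coef0 if_same.
exists (\matrix_i xchoose (ex i)); apply/row_matrixP => i.
by rewrite row_mul rowK row1; apply/eqP/(xchooseP (ex i)).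
Qed.

End Reversal.

Section PolynomialsAsCoefficients.
Variables (R : realType) (d m : nat).
Local Notation C := R[i].
Implicit Types P Q : POLss R d m.

Lemma coef_mxpoly P i j k : (mxpoly P i j)`_k = if insub k is Some k' then P k' i j else 0.
Proof.
rewrite /mxpoly summxE coef_sum; case: insubP => [k' hk <-|hk].
  rewrite (bigD1 k') //= !mxE coefMC coefXn eqxx mul1r big1 ?addr0 // => l lk.
  by rewrite !mxE coefMC coefXn eq_sym (inj_eq val_inj) (negPf lk) mul0r.
rewrite big1 // => l _; rewrite !mxE coefMC coefXn; case: eqP => [E|_]; last by rewrite mul0r.
by move: hk; rewrite E ltn_ord.
Qed.

Lemma coef_mxpoly_ord P i j (k : 'I_d.+1) : (mxpoly P i j)`_k = P k i j.
Proof. by rewrite coef_mxpoly valK. Qed.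

Lemma size_mxpoly P i j : (size (mxpoly P i j) <= d.+1)%N.
Proof.
by apply/leq_sizeP => k dk; rewrite coef_mxpoly; case: insubP => // k' hk; rewrite ltnNge dk in hk.
Qed.

Lemma mxpoly_skew P : (mxpoly P)^T = - mxpoly P.
Proof.
apply/matrixP => i j; rewrite !mxE; apply/polyP => k; rewrite coefN !coef_mxpoly.
case: insubP => [k' _ _|_]; last by rewrite oppr0.
case: P => f /= /forallP/(_ k') /eqP/matrixP/(_ i j).
by rewrite !mxE.
Qed.

Lemma mxpoly_surj (A : 'M[{poly C}]_m) : A^T = - A -> (forall i j, (size (A i j) <= d.+1)%N) ->
  exists P, mxpoly P = A.
Proof.
move=> As sA; pose f := [ffun k : 'I_d.+1 => \matrix_(i, j) (A i j)`_k : 'M[C]_m].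
have fs : [forall k, (f k)^T == - f k].
  apply/forallP => k; apply/eqP/matrixP => i j; rewrite !ffunE !mxE -coefN.
  by have /matrixP/(_ i j) := As; rewrite !mxE => ->.
exists (MkPOLss fs); apply/matrixP => i j; apply/polyP => k; rewrite coef_mxpoly.
case: insubP => [k' _ <-|]; first by rewrite /= ffunE mxE.
by rewrite -leqNgt => dk; rewrite nth_default //; apply: leq_trans (sA i j) dk.
Qed.

Lemma mxpoly_revd P : mxpoly (revd P) = map_mx (@revp C d) (mxpoly P).
Proof.
apply/matrixP => i j; rewrite [RHS]mxE; apply/polyP => k; rewrite coef_mxpoly coef_poly.
case: insubP => [k' hk <-|/negbTE->] //; rewrite ltn_ord /= ffunE -coef_mxpoly_ord /=.
by rewrite subSS.
Qed.

End PolynomialsAsCoefficients.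

(** * Topology of the space of polynomials *)
Section NormTools.
Variable R : realType.
Local Notation C := R[i].
Local Notation nc := (@ComplexField.Normc.normc R).

Lemma normc_ge0 (z : C) : 0 <= nc z.
Proof. by case: z => x y; exact: sqrtr_ge0. Qed.

Lemma normc_sum (I : Type) (s : seq I) (f : I -> C) : nc (\sum_(i <- s) f i) <= \sum_(i <- s) nc (f i).
Proof.
elim: s => [|i s IH]; first by rewrite !big_nil ComplexField.Normc.normc0.
by rewrite !big_cons; apply: le_trans (le_normcD _ _) _; rewrite lerD2l.
Qed.

Lemma normc_real (x : R) : 0 <= x -> nc x%:C = x.
Proof. by move=> x0; rewrite /= expr0n /= addr0 sqrtr_sqr ger0_norm. Qed.

(** The largest coordinate of a vector in the kernel would be at most n eta times
    itself. *)
Lemma near_identity_unit n (M : 'M[C]_n) (eta : R) : n%:R * eta < 1 ->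
  (forall i j, nc (M i j - (i == j)%:R) <= eta) -> M \in unitmx.
Proof.
move=> heta hM; rewrite unitmxE unitfE; apply/negP => /det0P[v v0 vM].
have [i0 vi0] := rV0Pn _ v0.
have [j _ jmax] := @arg_maxP _ _ _ i0 predT (fun k => nc (v 0 k)) isT.
have jm k : nc (v 0 k) <= nc (v 0 j) by exact: jmax.
have vj : 0 < nc (v 0 j).
  apply: lt_le_trans (jm i0); rewrite lt_neqAle normc_ge0 andbT eq_sym.
  by apply: contra vi0 => /eqP/ComplexField.Normc.eq0_normc ->.
have E : v 0 j = - \sum_k v 0 k * (M k j - (k == j)%:R).
  have := congr1 (fun A : 'rV_n => A 0 j) vM; rewrite !mxE => h.
  under eq_bigr do rewrite mulrBr; rewrite sumrB h sub0r opprK (bigD1 j) //= eqxx mulr1 big1 ?addr0 //.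
  by move=> k /negPf->; rewrite mulr0.
have : nc (v 0 j) <= n%:R * eta * nc (v 0 j).
  rewrite {1}E normcN; apply: le_trans (normc_sum _ _) _.
  apply: (@le_trans _ _ (\sum_(k < n) eta * nc (v 0 j))); last first.
    by rewrite sumr_const card_ord -mulrA mulr_natl.
  apply: ler_sum => k _; rewrite ComplexField.Normc.normcM mulrC.
  by apply: ler_pM; rewrite ?normc_ge0.
by rewrite leNgt gtr_pMl // heta.
Qed.

End NormTools.

Section Topology.
Variables (R : realType) (d m : nat).
Local Notation C := R[i].
Local Notation nc := (@ComplexField.Normc.normc R).
Implicit Types P Q : POLss R d m.

Lemma POLdist_sqr P Q : POLdist P Q = Num.sqrt (\sum_k \sum_i \sum_j nc (P k i j - Q k i j) ^+ 2).
Proof.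
congr (Num.sqrt _); apply: eq_bigr => k _; rewrite sqr_sqrtr.
  by apply: eq_bigr => i _; apply: eq_bigr => j _; rewrite !mxE.
by apply: sumr_ge0 => i _; apply: sumr_ge0 => j _; exact: sqr_ge0.
Qed.

Lemma entry_le_POLdist P Q k i j : nc (P k i j - Q k i j) <= POLdist P Q.
Proof.
rewrite POLdist_sqr -(ger0_norm (normc_ge0 _)) -sqrtr_sqr; apply: ler_wsqrtr.
rewrite (bigD1 k) //= (bigD1 i) //= (bigD1 j) //= -!addrA lerDl.
by rewrite !addr_ge0 //; do ?[apply: sumr_ge0 => ? _]; exact: sqr_ge0.
Qed.

Lemma POLdist_le P Q (M : 'I_d.+1 -> 'I_m -> 'I_m -> R) (t : R) : 0 <= t ->
  (forall k i j, nc (P k i j - Q k i j) <= t * M k i j) ->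
  POLdist P Q <= t * Num.sqrt (\sum_k \sum_i \sum_j M k i j ^+ 2).
Proof.
move=> t0 h; rewrite POLdist_sqr -{1}(ger0_norm t0) -(sqrtr_sqr t) -sqrtrM ?sqr_ge0 //.
apply: ler_wsqrtr; rewrite mulr_sumr; apply: ler_sum => k _.
rewrite mulr_sumr; apply: ler_sum => i _; rewrite mulr_sumr; apply: ler_sum => j _.
rewrite -exprMn ler_pXn2r ?nnegrE ?normc_ge0 //.
by apply: le_trans (h k i j); exact: normc_ge0.
Qed.

Lemma closure_POLP (T : set (POLss R d m)) P :
  closure T P <-> forall e, 0 < e -> exists2 Q, T Q & POLdist P Q < e.
Proof.
split=> [clT e e0|h U /nbhs_ballP[e /= e0 eU]].
  have [Q [TQ PQ]] := clT _ (nbhsx_ballx P e e0).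
  by exists Q.
by have [Q TQ PQ] := h e e0; exists Q; split=> //; apply: eU.
Qed.

(** Quadratic paths suffice: wedge is bilinear, and its two arguments are only
    deformed linearly. *)
Lemma path_closure (T : set (POLss R d m)) P (A B : 'M[{poly C}]_m) (f : {poly C}) : f != 0 ->
  (forall t, f.[t] != 0 -> exists2 Q, T Q & mxpoly Q = mxpoly P + t%:P *: A + (t ^+ 2)%:P *: B) ->
  closure T P.
Proof.
move=> f0 hT; apply/closure_POLP => e e0.
pose M (k : 'I_d.+1) i j := nc ((A i j)`_k) + nc ((B i j)`_k).
set S := Num.sqrt (\sum_k \sum_i \sum_j M k i j ^+ 2).
have S0 : 0 <= S by exact: sqrtr_ge0.
(* For 0 <= t <= 1 the path stays within t S of P. *)
pose del := Num.min 1 (e / (S + 1)).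
have del0 : 0 < del by rewrite lt_min ltr01 divr_gt0 // ltr_wpDl.
pose u (n : nat) : R := del / (n.+1%:R).
have u0 n : 0 < u n by rewrite divr_gt0.
have udel n : u n <= del by rewrite ler_pdivrMr //; apply: ler_peMr; [exact: ltW|rewrite ler1n].
have ui : injective (fun n => (u n)%:C).
  move=> n n' /complexI /(mulfI (lt0r_neq0 del0)) /invr_inj /eqP.
  by rewrite eqr_nat => /eqP[].
have [n /hT[Q TQ EQ]] := nonroot_seq ui f0.
exists Q => //; set t := u n in EQ.
have t0 : 0 <= t by exact: ltW (u0 n).
have t1 : t <= 1 by apply: le_trans (udel n) _; rewrite ge_min lexx.
apply: (@le_lt_trans _ _ (t * S)).
  apply: POLdist_le => // k i j; rewrite -(coef_mxpoly_ord Q) EQ !mxE !coefD !coefCM coef_mxpoly_ord.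
  rewrite -addrA opprD addNKr. rewrite normcN.
  apply: le_trans (le_normcD _ _) _; rewrite !ComplexField.Normc.normcM mulrDr normc_real //.
  by rewrite lerD2l ler_wpM2r ?normc_ge0 // ler_piMl.
have : t * (S + 1) <= e.
  by rewrite -ler_pdivlMr ?ltr_wpDl //; apply: le_trans (udel n) _; rewrite ge_min lexx orbT.
by apply: lt_le_trans; rewrite mulrDr mulr1 ltrDl; exact: (u0 n).
Qed.

End Topology.

Section RankAtPoints.
Variable R : realType.
Local Notation C := R[i].

Lemma rank_at_le_prank m n (A : 'M[{poly C}]_(m, n)) a :
  (\rank (map_mx (horner_eval a) A) <= prank A)%N.
Proof.
have [f [g]] := minor_exists (map_mx (horner_eval a) A).
rewrite -map_mxsub unitmxE det_map_mx unitfE => d0.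
have : (map_mx (@tofrac {poly C}) (mxsub f g A)) \in unitmx.
  rewrite unitmxE det_map_mx unitfE tofrac_eq0.
  by apply: contraNneq d0 => ->; rewrite rmorph0.
rewrite map_mxsub => /mxrank_unit {1}<-; exact: rank_mxsub.
Qed.

Lemma prank_attained m n (A : 'M[{poly C}]_(m, n)) :
  exists a, (prank A <= \rank (map_mx (horner_eval a) A))%N.
Proof.
have [f [g]] := minor_exists (fracmx A).
rewrite /fracmx -map_mxsub unitmxE det_map_mx unitfE tofrac_eq0 => /poly_nonroot[k hk].
exists k%:R; have : (map_mx (horner_eval k%:R) (mxsub f g A)) \in unitmx.
  by rewrite unitmxE det_map_mx unitfE.
rewrite map_mxsub /prank => /mxrank_unit {1}<-; exact: rank_mxsub.
Qed.

Local Notation nc := (@ComplexField.Normc.normc R).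

(** A minor which is invertible at some point a remains so for polynomials close
    to P: multiplied by the inverse of its value for P, it is close to the
    identity. *)
Lemma prank_le_closed d m s (P : POLss R d m) :
  closure [set Q : POLss R d m | (prank (mxpoly Q) <= s)%N] P -> (prank (mxpoly P) <= s)%N.
Proof.
move=> /closure_POLP clP; have [a ha] := prank_attained (mxpoly P).
apply: leq_trans ha _; rewrite leqNgt; apply/negP => hs.
have [f [g]] := minor_exists (map_mx (horner_eval a) (mxpoly P)).
set M0 := mxsub f g _ => uM0; set rho := \rank _ in f g M0 uM0 hs.
pose W := invmx M0.
pose c1 := \sum_(l < d.+1) nc (a ^+ l).
pose c2 := \sum_k \sum_j nc (W k j).
have c10 : 0 <= c1 by apply: sumr_ge0 => ? _; exact: normc_ge0.
have c20 : 0 <= c2 by apply: sumr_ge0 => ? _; apply: sumr_ge0 => ? _; exact: normc_ge0.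
have D0 : 0 < rho%:R * (c1 * c2) + 1 by rewrite ltr_wpDl // !mulr_ge0.
have [|Q hQ PQ] := clP (rho%:R * (c1 * c2) + 1)^-1; first by rewrite invr_gt0.
pose MQ := mxsub f g (map_mx (horner_eval a) (mxpoly Q)).
have MW i j : (MQ *m W) i j - (i == j)%:R = \sum_k (\sum_l (Q l (f i) (g k) - P l (f i) (g k)) * a ^+ l) * W k j.
  have -> : (i == j)%:R = (M0 *m W) i j by rewrite mulmxV // mxE.
  rewrite !mxE -sumrB; apply: eq_bigr => k _; rewrite -mulrBl; congr (_ * _).
  rewrite !mxE /horner_eval !(horner_coef_wide _ (size_mxpoly _ _ _)) -sumrB.
  by apply: eq_bigr => l _; rewrite !coef_mxpoly_ord mulrBl.
have : MQ *m W \in unitmx.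
  apply: (@near_identity_unit _ _ _ (POLdist P Q * (c1 * c2))).
    rewrite mulrCA; apply: (@le_lt_trans _ _ ((rho%:R * (c1 * c2) + 1)^-1 * (rho%:R * (c1 * c2)))).
      by apply: ler_wpM2r; [rewrite !mulr_ge0|exact: ltW].
    by rewrite mulrC ltr_pdivrMr // mul1r ltrDl ltr01.
  move=> i j; rewrite MW; apply: le_trans (normc_sum _ _) _.
  rewrite /c2 mulrA mulr_sumr; apply: ler_sum => k _.
  rewrite ComplexField.Normc.normcM; apply: ler_pM; rewrite ?normc_ge0 //.
    apply: le_trans (normc_sum _ _) _; rewrite mulr_sumr; apply: ler_sum => l _.
    rewrite ComplexField.Normc.normcM ler_wpM2r ?normc_ge0 //.
    by rewrite -normcN opprB; exact: entry_le_POLdist.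
  by rewrite (bigD1 j) //= lerDl; apply: sumr_ge0 => ? _; exact: normc_ge0.
rewrite unitmx_mul => /andP[/mxrank_unit rk _].
have := leq_trans (rank_at_le_prank (mxpoly Q) a) hQ.
by rewrite leqNgt; apply/negP; rewrite negbK; apply: leq_trans hs _; rewrite -rk; exact: rank_mxsub.
Qed.

End RankAtPoints.

(** * Generic wedges are dense in the polynomials of bounded rank *)
Section GenericWedges.
Variable R : realType.
Variables (m r h b t : nat).
Local Notation C := R[i].
Let d := (h + h)%N.
Let n := (m - (r + r))%N.
Hypothesis am : (r + r <= m)%N.
Hypothesis tn : (t <= n)%N.
Hypothesis degrees_sum : ((r + r) * h = n * b + t)%N.
Let indices := nseq (n - t) b ++ nseq t b.+1.

Definition generic_wedge (P : POLss R d m) :=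
  exists X Y : 'M[{poly C}]_(m, r), generic_matrix h b (row_mx X Y) /\ mxpoly P = wedge X Y.

Lemma row_mx_size (X Y : 'M[{poly C}]_(m, r)) :
  (forall i j, (size (row_mx X Y i j) <= h.+1)%N) <->
  (forall i j, (size (X i j) <= h.+1)%N) /\ (forall i j, (size (Y i j) <= h.+1)%N).
Proof.
split=> [s|[sX sY] i j]; last by rewrite mxE; case: splitP => k _.
by split=> i j; [have := s i (lshift r j); rewrite row_mxEl|have := s i (rshift r j); rewrite row_mxEr].
Qed.

Lemma size_wedge (X Y : 'M[{poly C}]_(m, r)) :
  (forall i j, (size (X i j) <= h.+1)%N) -> (forall i j, (size (Y i j) <= h.+1)%N) ->
  forall i j, (size (wedge X Y i j) <= d.+1)%N.
Proof.
move=> sX sY i j; rewrite wedgeE; apply: leq_trans (size_sum _ _ _) _; apply/bigmax_leqP => k _.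
have s2 (p q : {poly C}) : (size p <= h.+1)%N -> (size q <= h.+1)%N -> (size (p * q)%R <= d.+1)%N.
  move=> sp sq; apply: leq_trans (size_polyMleq _ _) _; rewrite /d.
  by move: (size p) (size q) sp sq => x y; lia.
by apply: leq_trans (size_polyD _ _) _; rewrite size_polyN geq_max !s2.
Qed.

Lemma wedge_polynomial (X Y : 'M[{poly C}]_(m, r)) :
  (forall i j, (size (X i j) <= h.+1)%N) -> (forall i j, (size (Y i j) <= h.+1)%N) ->
  exists P : POLss R d m, mxpoly P = wedge X Y.
Proof. by move=> sX sY; apply: mxpoly_surj; [exact: tr_wedge|exact: size_wedge]. Qed.

Lemma generic_wedge_rev P : generic_wedge P -> exists X Y (G : 'M[{poly C}]_(r + r, m)),
  G *m row_mx X Y = 1%:M /\ mxpoly (revd P) = wedge X Y.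
Proof.
case=> X [Y [gB EP]]; have [sB _ _] := gB; have [sX sY] := (row_mx_size X Y).1 sB.
have [G GB] := generic_rev_left_inverse gB.
exists (map_mx (@revp _ h) X), (map_mx (@revp _ h) Y), G; split.
  by rewrite -map_row_mx.
by rewrite mxpoly_revd EP revp_wedge.
Qed.

Lemma generic_wedge_prank P : generic_wedge P -> prank (mxpoly P) = (r + r)%N.
Proof.
by case=> X [Y [gB ->]]; have [G GB] := generic_left_inverse gB; exact: prank_wedge GB.
Qed.

Lemma generic_wedge_elementary P a e : generic_wedge P ->
  elementary_divisors (mxpoly P) a e <-> e = [::].
Proof.
by case=> X [Y [gB ->]]; have [G GB] := generic_left_inverse gB; exact: wedge_elementary_divisors GB _ _.
Qed.

Lemma generic_wedge_infinite P e : generic_wedge P ->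
  infinite_elementary_divisors P e <-> e = [::].
Proof.
move=> /generic_wedge_rev[X [Y [G [GB E]]]]; rewrite /infinite_elementary_divisors E.
exact: wedge_elementary_divisors GB _ _.
Qed.

Lemma generic_wedge_left P s : generic_wedge P ->
  left_minimal_indices (mxpoly P) s <-> s = indices.
Proof. by case=> X [Y [gB ->]]; exact: (wedge_left_minimal_indices am tn degrees_sum gB). Qed.

Lemma generic_wedge_right P s : generic_wedge P ->
  right_minimal_indices (mxpoly P) s <-> s = indices.
Proof. by case=> X [Y [gB ->]]; exact: (wedge_right_minimal_indices am tn degrees_sum gB). Qed.

Lemma generic_wedge_orbit P Q : generic_wedge P -> generic_wedge Q -> same_eigenstructure P Q.
Proof.
have noeig P' a : generic_wedge P' -> ~ Defs.eigenvalue (mxpoly P') a.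
  case=> X [Y [gB ->]]; have [G GB] := generic_left_inverse gB.
  exact: wedge_not_eigenvalue GB _.
have noinf P' : generic_wedge P' -> ~ infinite_eigenvalue P'.
  move=> /generic_wedge_rev[X [Y [G [GB E]]]]; rewrite /infinite_eigenvalue E.
  exact: wedge_not_eigenvalue GB _.
move=> gP gQ; split=> [a||a e|e|s|s].
- by split=> ev; exfalso; [apply: (noeig P a)|apply: (noeig Q a)].
- by split=> ev; exfalso; [apply: (noinf P)|apply: (noinf Q)].
- by rewrite !generic_wedge_elementary.
- by rewrite !generic_wedge_infinite.
- by rewrite !generic_wedge_left.
- by rewrite !generic_wedge_right.
Qed.

(** The eigenstructure determines the rank, because the number of left minimal
    indices is the dimension of the left null space. *)
Lemma orbit_prank P Q : generic_wedge P -> same_eigenstructure P Q -> prank (mxpoly Q) = (r + r)%N.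
Proof.
move=> gP /same_left_minimal_indices/(_ indices)[/(_ ((generic_wedge_left _ gP).2 erefl))].
case=> X [bX _] /(congr1 size); rewrite size_sort size_map size_cat !size_nseq subnK // => sX _.
have : \dim (left_nullspace (mxpoly Q)) = size X.
  by case/andP: bX => /eqP <- /eqnP ->; rewrite size_map.
rewrite dim_left_nullspace -sX /n => E.
by have := rank_leq_row (fracmx (mxpoly Q)); rewrite -/(prank _); lia.
Qed.

(** The coefficient of degree d is the value at 0 of the reversal, which has rank
    2r there as everywhere. *)
Lemma generic_wedge_degree P : (0 < r)%N -> generic_wedge P -> degree P = d.
Proof.
move=> r0 /generic_wedge_rev[X [Y [G [GB E]]]].
have P0 : P ord_max != 0.
  have := rank_map_wedge (horner_eval (0 : C)) GB; rewrite -E => rk.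
  apply: contra_eq_neq rk => P0; suff -> : map_mx (horner_eval 0) (mxpoly (revd P)) = 0.
    by rewrite mxrank0 ltn_eqF // addn_gt0 r0.
  apply/matrixP => i j; rewrite !mxE /horner_eval horner_coef0.
  have -> : 0%N = (ord0 : 'I_d.+1) by [].
  rewrite coef_mxpoly_ord /= ffunE (_ : rev_ord ord0 = ord_max); last by apply: val_inj; rewrite /= subn1.
  by rewrite P0 mxE.
apply/eqP; rewrite eqn_leq; apply/andP; split.
  by apply/bigmax_leqP => i _; rewrite -ltnS.
by rewrite /degree (bigD1 ord_max) //= leq_maxl.
Qed.

(** With n = m - 2r and 2r h = n b + t, the inequalities between dimensions read
    n b <= n b + t and n b + t <= n (b + 1). *)
Lemma generic_wedge_exists : exists P, generic_wedge P.
Proof.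
have [||B gB] := @generic_matrix_exists C m (r + r) h b.
- rewrite mulnDr degrees_sum -[X in (X * _ <= _)%N](subnK am) -/n [X in (X <= _)%N]mulnDl; lia.
- rewrite mulnDr degrees_sum -[X in (_ <= X * _)%N](subnK am) -/n [X in (_ <= X)%N]mulnDl [(n * b.+1)%N]mulnS; lia.
have [sB _ _] := gB; have [] := (row_mx_size (lsubmx B) (rsubmx B)).1.
  by rewrite hsubmxK.
move=> sX sY; have [P EP] := wedge_polynomial sX sY.
by exists P, (lsubmx B), (rsubmx B); rewrite hsubmxK.
Qed.

Lemma wedge_closure_generic P (X Y : 'M[{poly C}]_(m, r)) :
  (forall i j, (size (X i j) <= h.+1)%N) -> (forall i j, (size (Y i j) <= h.+1)%N) ->
  mxpoly P = wedge X Y -> closure (generic_wedge : set (POLss R d m)) P.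
Proof.
move=> sX sY EP; have [P1 [X1 [Y1 [gB _]]]] := generic_wedge_exists.
have sB := (row_mx_size X Y).2 (conj sX sY).
have [f f0 hf] := generic_on_line sB gB.
apply: (path_closure (A := wedge X (Y1 - Y) + wedge (X1 - X) Y) (B := wedge (X1 - X) (Y1 - Y)) f0).
move=> t' /hf; rewrite opp_row_mx add_row_mx scale_row_mx add_row_mx => gt.
have [sBt _ _] := gt; have [sXt sYt] := (row_mx_size _ _).1 sBt.
have [Q EQ] := wedge_polynomial sXt sYt.
exists Q; first by exists (X + t'%:P *: (X1 - X)), (Y + t'%:P *: (Y1 - Y)).
rewrite EQ EP; move: (X1 - X) (Y1 - Y) => U V.
rewrite wedgeDl !wedgeDr !wedgeZl !wedgeZr scalerA -polyCM -expr2.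
by rewrite (scalerDr _ (wedge X V) (wedge U Y)) -!addrA.
Qed.

(** The limit of the balanced wedges of graded_wedge_balance, which are
    themselves limits of generic ones. *)
Lemma bounded_rank_closure_generic P : (prank (mxpoly P) <= r + r)%N ->
  closure (generic_wedge : set (POLss R d m)) P.
Proof.
move=> rkP; apply: (@closed_closure _ (generic_wedge : set (POLss R d m)) P).
have two0 : 2%:R != 0 :> C by rewrite pnatr_eq0.
have := @graded_wedge_decomposition C two0 _ m (fun=> 0%N) h.*2 r (mxpoly P) (leqnn _) (mxpoly_skew P).
case=> [i j||X0 [Y0 [a GW]]].
- by rewrite /wdeg_le mulr1 -addnn; exact: size_mxpoly.
- by rewrite -addnn.
have /graded_wedge_balance[E hE] : graded_wedge (fun=> 0%N) h.*2 r (mxpoly P) by exists X0, Y0, a.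
apply: (path_closure (A := E) (B := 0) (negbT (polyX_eq0 C))) => e; rewrite hornerX => e0.
have [X [Y [sX sY EXY]]] := hE e e0.
have [Q EQ] := wedge_polynomial sX sY.
exists Q; first exact: (wedge_closure_generic sX sY EQ).
by rewrite EQ EXY scaler0 addr0.
Qed.

End GenericWedges.

Theorem theorem4p3 (R : realType) (d m r : nat)
    (d_ge1 : (1 <= d)%N) (d_even : ~~ odd d)
    (m_ge2 : (2 <= m)%N) (r_ge1 : (2 <= 2 * r)%N) (r_le : (2 * r <= m - 1)%N) :
  let beta := ((r * d) %/ (m - 2 * r))%N in
  let t := ((r * d) %% (m - 2 * r))%N in
  let indices := nseq (m - 2 * r - t) beta ++ nseq t beta.+1 in
  exists W : POLss R d m,
    [/\ degree W = d,
        prank (mxpoly W) = (2 * r)%N,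
        (forall a : R[i], elementary_divisors (mxpoly W) a [::]) /\
          infinite_elementary_divisors W [::],
        left_minimal_indices (mxpoly W) indices /\
          right_minimal_indices (mxpoly W) indices
      & let S := [set P : POLss R d m | (prank (mxpoly P) <= 2 * r)%N] in
        closed S /\ S = closure (eigen_orbit W)].
Proof.
have [h dh] : exists h, d = (h + h)%N.
  by exists d./2; rewrite addnn even_halfK.
move: d_ge1 d_even; rewrite {}dh => _ _ {d} beta t indices.
have rr : (2 * r = r + r)%N by rewrite mul2n addnn.
have n0 : (0 < m - (r + r))%N by lia.
have am : (r + r <= m)%N by lia.
have tn : (t <= m - (r + r))%N by rewrite /t rr ltnW // ltn_mod.
have degrees_sum : ((r + r) * h = (m - (r + r)) * beta + t)%N.
  have := divn_eq (r * (h + h)) (m - 2 * r); rewrite -/beta -/t rr => E.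
  by rewrite mulnC mulnDr -mulnDl mulnC E mulnC.
have [W gW] := generic_wedge_exists R am tn degrees_sum.
exists W; split.
- by apply: (generic_wedge_degree _ gW); lia.
- by rewrite rr; exact: (generic_wedge_prank gW).
- by split=> [a|]; [apply/(generic_wedge_elementary _ _ gW)|apply/(generic_wedge_infinite _ gW)].
- rewrite /indices rr; split; first exact/(generic_wedge_left am tn degrees_sum _ gW).
  exact/(generic_wedge_right am tn degrees_sum _ gW).
move=> S; have clS : closed S by move=> P; exact: prank_le_closed.
split=> //; rewrite eqEsubset; split=> P.
  rewrite /S /= rr => /(bounded_rank_closure_generic am tn degrees_sum).
  apply: closureS => Q gQ; exact: (generic_wedge_orbit am tn degrees_sum gW gQ).
move=> clP; apply: clS; move: P clP; apply: closureS => Q.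
by rewrite /S /= rr => /(orbit_prank am tn degrees_sum gW) ->.
Qed.
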